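(* Let $F$ be a continuous distribution function on $\mathcal{X}\subseteq\mathbb{R}^p$ with finite energy distances, and let $\lambda\in[0,1]$. Let $n=\sum_{k=1}^K n_k(n)$ and $\lim_{n\to\infty}\frac{n_k(n)}{n}=c_k>0$ for all $k=1,\ldots,K$. Suppose that the point set $\mathcal{P}_n^*=\bigcup_{k=1}^K\mathcal{P}^*_{n_k(n)}$ is generated by solving $$\min_{\mathcal{P}_{n_1},\ldots,\mathcal{P}_{n_K}\subseteq\mathcal{X}}E^\lambda(F,F_{\mathcal{P}_n}),\qquad E^\lambda(F,F_{\mathcal{P}_n})=\lambda E(F,F_{\mathcal{P}_n})+(1-\lambda)\sum_{k=1}^K\frac{n_k}{n}E(F,F_{\mathcal{P}_{n_k}}),$$ where $\mathcal{P}_n=\bigcup_{k=1}^K\mathcal{P}_{n_k}$ and $\mathcal{P}_{n_k}$ has $n_k=n_k(n)$ points. Then, as $n\to\infty$, $F_{\mathcal{P}_n^*}\stackrel{d}{\longrightarrow}F$ and $F_{\mathcal{P}^*_{n_k(n)}}\stackrel{d}{\longrightarrow}F$ for every $k=1,\ldots,K$.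
   Context: Point sets are finite indexed families of points (repetitions allowed and counted with multiplicity), and unions of subsets are unions of indexed families. $F_{\mathcal{P}}$ denotes the empirical distribution function of a point set $\mathcal{P}$. $K$ is fixed; $n_k(n)$ is a positive integer depending on the total sample size $n$. For $Y,Y'\stackrel{i.i.d.}{\sim}F$, the energy distance between $F$ and $F_{\mathcal{P}_n}$, $\mathcal{P}_n=\{\boldsymbol{x}_i\}_{i=1}^n$, is $$E(F,F_{\mathcal{P}_n})=\frac{2}{n}\sum_{i=1}^n\mathbb{E}\|\boldsymbol{x}_i-Y\|_2-\frac{1}{n^2}\sum_{i=1}^n\sum_{j=1}^n\|\boldsymbol{x}_i-\boldsymbol{x}_j\|_2-\mathbb{E}\|Y-Y'\|_2 ,$$ assuming these expectations are finite.
   Formalization: Convergence of the individual slices is claimed only for λ<1 or K=1: for λ=1 and K≥2 the objective depends only on the union, so a minimizer's points can be split among slices so that no slice converges to F (e.g. sorted points for the uniform law). *)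

(* Defs.v *)
From HB Require Import structures.
From mathcomp Require Import all_boot all_order all_algebra.
From mathcomp Require Import all_classical all_reals all_analysis.

Set Implicit Arguments.
Unset Strict Implicit.
Unset Printing Implicit Defensive.

Import Order.TTheory GRing.Theory Num.Theory.
Import numFieldNormedType.Exports.

Local Open Scope classical_set_scope.
Local Open Scope ring_scope.

(* The Borel measurable space on R^p: the sigma-algebra generated by the open
   sets of 'rV[R]_p (whose library topology is the product topology). *)
Definition borel_rV (R : realType) (p : nat) :=
  g_sigma_algebraType (@open 'rV[R]_p).

(* The library norm `|x| on 'rV[R]_p is the sup norm, not the Euclidean one. *)
Definition norm2 (R : realType) (p : nat) (x : 'rV[R]_p) : R :=
  Num.sqrt (\sum_(j < p) x 0 j ^+ 2).

Definition joint_cdf (R : realType) (p : nat)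
    (mu : probability (borel_rV R p) R) (t : 'rV[R]_p) : R :=
  fine (mu [set y : 'rV[R]_p | forall j, y 0 j <= t 0 j]).

(* A point set is a family x : I -> R^p indexed by a finite type I, so that
   repeated points count with multiplicity and its size is #|I|. *)
Definition empirical_cdf (R : realType) (p : nat) (I : finType)
    (x : I -> 'rV[R]_p) (t : 'rV[R]_p) : R :=
  (\sum_i ([forall j, x i 0 j <= t 0 j] : nat)%:R) / #|I|%:R.

(* For x in X, E|x - Y| and E|Y - Y'| are finite, where Y, Y' are independent
   with law mu, i.e. (Y, Y') has law mu \x mu. *)
Definition finite_energy (R : realType) (p : nat)
    (mu : probability (borel_rV R p) R) (X : set 'rV[R]_p) : Prop :=
  (forall x, X x ->
    mu.-integrable setT (fun y : borel_rV R p => (norm2 (x - y))%:E)) /\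
  (mu \x mu)%E.-integrable setT
    (fun z : borel_rV R p * borel_rV R p => (norm2 (z.1 - z.2))%:E).

(* The energy distance between the law mu and the empirical distribution of x. *)
Definition energy (R : realType) (p : nat)
    (mu : probability (borel_rV R p) R) (I : finType) (x : I -> 'rV[R]_p) : R :=
  2 / #|I|%:R * (\sum_i \int[mu]_y norm2 (x i - y))
  - (#|I|%:R ^+ 2)^-1 * (\sum_i \sum_j norm2 (x i - x j))
  - \int[(mu \x mu)%E]_z norm2 (z.1 - z.2).

Definition slices (R : realType) (p K : nat) (m : 'I_K -> nat) :=
  forall k : 'I_K, 'I_(m k) -> 'rV[R]_p.

(* The union of the slices as an indexed family: its index type is the disjoint
   union of the index types 'I_(m k). *)
Definition union_slices (R : realType) (p K : nat) (m : 'I_K -> nat)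
    (x : slices R p m) (u : {k : 'I_K & 'I_(m k)}) : 'rV[R]_p :=
  x (tag u) (tagged u).

Definition sliced_energy (R : realType) (p : nat)
    (mu : probability (borel_rV R p) R) (lambda : R)
    (K : nat) (m : 'I_K -> nat) (x : slices R p m) : R :=
  lambda * energy mu (union_slices x)
  + (1 - lambda) *
    \sum_k (m k)%:R / (\sum_l m l)%N%:R * energy mu (x k).

Definition minimizes_sliced_energy (R : realType) (p : nat)
    (mu : probability (borel_rV R p) R) (X : set 'rV[R]_p) (lambda : R)
    (K : nat) (m : 'I_K -> nat) (x : slices R p m) : Prop :=
  (forall k i, X (x k i)) /\
  forall y : slices R p m, (forall k i, X (y k i)) ->
    sliced_energy mu lambda x <= sliced_energy mu lambda y.

Definition cvg_in_distribution (R : realType) (p : nat)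
    (G : nat -> 'rV[R]_p -> R) (F : 'rV[R]_p -> R) : Prop :=
  forall t : 'rV[R]_p, {for t, continuous F} -> G n t @[n --> \oo] --> F t.

(* Main.v *)
Require Import Defs.
From HB Require Import structures.
From mathcomp Require Import all_boot all_order all_algebra.
From mathcomp Require Import all_classical all_reals all_analysis.
From mathcomp Require Import measurable_realfun ring lra.

Set Implicit Arguments.
Unset Strict Implicit.
Unset Printing Implicit Defensive.

Import Order.TTheory GRing.Theory Num.Theory.
Import numFieldNormedType.Exports.

Local Open Scope classical_set_scope.
Local Open Scope ring_scope.

(** Let h(x) be the mean of |x - Y| under mu, D the mean of |Y - Y'|, and
    k(x, y) = h(x) + h(y) - |x - y| - D. The energy distance of a family of n
    points is the mean of k over the n^2 pairs of its points ([energyE]), and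
    k(x, .) has mean zero for x in X.

    Minimizers have a small energy. A combination of the values of k over the
    slots of a family, averaged over independent points, only keeps its diagonal
    terms. Choosing the points of X one at a time, each where the partial
    objective does not exceed its mean ([greedy_sample]), yields slices whose
    sliced energy is at most (lambda + (1 - lambda) K) D / n
    ([exists_small_sliced_energy]), and the minimizers do at least as well.

    A small energy forces convergence. On finite signed measures of mass zero the
    kernel - |x - y| is a positive mixture of the kernels 1 / (|x - y|^2 + v^2),
    which are positive mixtures of Gaussian kernels, which are positive
    semidefinite because the powers of an inner product are. Both mixtures have
    explicit primitives in the mixing parameter (an arctangent and an
    exponential), so they only need that a function with a nonnegative derivative
    increases. Cauchy-Schwarz then bounds the squared discrepancy of a test
    function by the energy, for differences of finite measures
    ([laplace_band_dominated]). The bound passes to mu itself on replacing mu by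
    greedily chosen points, whose number tends to infinity
    ([energy_dominated_le]). Uniform limits of these test functions give all the
    Gaussians; products of Gaussians are Gaussians, so convergence of averages
    holds on the algebra that they generate together with the constants
    ([avg_cvg_gauss_alg]).

    This algebra contains 1 - (1 - exp (- |y - z|^2)) ^ N with N close to
    exp (L^2), which is almost the indicator of the ball of centre z and radius L;
    for z far away and L large the ball looks like a half-space
    ([halfspace_approx]). Polynomials in such functions approximate, from below up
    to a small error, the indicators of the open orthant below t and of the
    complement of the closed one. Hence the empirical measures give asymptotically
    at least their mu-mass to both sets ([open_liminf]), which is convergence of the
    distribution functions at each continuity point t ([cdf_cvg]).

    If lambda < 1, the energy of each slice tends to 0, and the distribution
    function of the union is the weighted mean of those of the slices. If
    lambda = 1, the energy of the union tends to 0. *)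

(** * Quadratic forms of radial kernels *)

Lemma cvg_sumT (R : realType) (T : Type) (F : set_system T) (FF : Filter F)
    (I : Type) (r : seq I) (P : pred I) (f : T -> I -> R) (l : I -> R) :
  (forall i, P i -> f t i @[t --> F] --> l i) ->
  \sum_(i <- r | P i) f t i @[t --> F] --> \sum_(i <- r | P i) l i.
Proof. by apply: cvg_big => //; exact: add_continuous. Qed.

Lemma is_derive_sumT (R : realType) (I : finType) (h : I -> R -> R) (dh : I -> R)
    (t : R) :
  (forall i, is_derive t 1 (h i) (dh i)) ->
  is_derive t 1 (\sum_i h i) (\sum_i dh i).
Proof.
by elim/big_ind2 : _ => // [|] *; [exact: is_derive_cst|exact: is_deriveD].
Qed.

Section radial_forms.
Context {R : realType} {p : nat}.

Definition sqdist (x y : 'rV[R]_p) : R := \sum_j (x 0 j - y 0 j) ^+ 2.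

Lemma sqdist_ge0 x y : 0 <= sqdist x y.
Proof. by apply: sumr_ge0 => j _; rewrite sqr_ge0. Qed.

Lemma sqdistxx x : sqdist x x = 0.
Proof. by rewrite /sqdist big1// => j _; rewrite subrr expr0n. Qed.

Lemma sqdistC x y : sqdist x y = sqdist y x.
Proof. by apply: eq_bigr => j _; rewrite -opprB sqrrN. Qed.

Lemma norm2_sqdist (x y : 'rV[R]_p) : norm2 (x - y) = Num.sqrt (sqdist x y).
Proof. by congr Num.sqrt; apply: eq_bigr => j _; rewrite !mxE. Qed.

(** The energy of the finite signed measure with masses a at the points x, for
    the radial kernel f (|x - y|^2). *)
Definition qform (I : finType) (a : I -> R) (x : I -> 'rV[R]_p) (f : R -> R) :=
  \sum_i \sum_j a i * a j * f (sqdist (x i) (x j)).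

Section fixed_points.
Variables (I : finType) (a : I -> R) (x : I -> 'rV[R]_p).
Local Notation q := (qform a x).

Lemma eq_qform f g : (forall u, 0 <= u -> f u = g u) -> q f = q g.
Proof.
by move=> fg; apply: eq_bigr => i _; apply: eq_bigr => j _; rewrite fg ?sqdist_ge0.
Qed.

Lemma qformD f g : q (fun u => f u + g u) = q f + q g.
Proof.
rewrite /qform -big_split; apply: eq_bigr => i _ /=.
by rewrite -big_split; apply: eq_bigr => j _ /=; rewrite mulrDr.
Qed.

Lemma qformZ c f : q (fun u => c * f u) = c * q f.
Proof.
rewrite /qform mulr_sumr; apply: eq_bigr => i _ /=.
by rewrite mulr_sumr; apply: eq_bigr => j _ /=; rewrite mulrCA.
Qed.

Lemma qformN f : q (fun u => - f u) = - q f.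
Proof. by rewrite -mulN1r -qformZ; apply: eq_qform => u _; rewrite mulN1r. Qed.

Lemma qformB f g : q (fun u => f u - g u) = q f - q g.
Proof. by rewrite qformD qformN. Qed.

Lemma qform_cst c : q (fun=> c) = c * (\sum_i a i) ^+ 2.
Proof.
rewrite expr2 mulrC -mulrA mulr_suml /qform; apply: eq_bigr => i _.
by rewrite mulr_suml mulr_sumr; apply: eq_bigr => j _; rewrite mulrA.
Qed.

Lemma qform_cvg (T : Type) (F : set_system T) (FF : Filter F)
    (f : T -> R -> R) (g : R -> R) :
  (forall u, 0 <= u -> f t u @[t --> F] --> g u) -> q (f t) @[t --> F] --> q g.
Proof.
move=> fg; apply: cvg_sumT => i _; apply: cvg_sumT => j _.
by apply: cvgMl_tmp; apply: fg; exact: sqdist_ge0.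
Qed.

Lemma qform_is_derive (f : R -> R -> R) (df : R -> R) (t : R) :
  (forall u, 0 <= u -> is_derive t 1 (f ^~ u) (df u)) ->
  is_derive t 1 (fun s => q (f s)) (q df).
Proof.
move=> fdf.
have E : (fun s => q (f s)) = \sum_i \sum_j (a i * a j) \*: f ^~ (sqdist (x i) (x j)).
  apply/funext => s; rewrite fct_sumE; apply: eq_bigr => i _.
  by rewrite fct_sumE.
rewrite E /qform; apply: is_derive_sumT => i; apply: is_derive_sumT => j.
by apply: is_deriveZ; apply: fdf; exact: sqdist_ge0.
Qed.

End fixed_points.
End radial_forms.

Section gaussian_forms.
Context {R : realType} {p : nat} (I : finType) (a : I -> R) (x : I -> 'rV[R]_p).
Local Notation q := (qform a x).

(** Integration in a mixing parameter without integrals: if the t-derivative of a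
    family of kernels has nonnegative forms, the form increases with t. *)
Lemma qform_increment (f df : R -> R -> R) (t0 t1 : R) : t0 <= t1 ->
  (forall t u : R, 0 <= u -> is_derive t 1 (f ^~ u) (df t u)) ->
  (forall t, t0 < t < t1 -> 0 <= q (df t)) ->
  q (f t0) <= q (f t1).
Proof.
move=> t01 fdf df0.
have D (t : R) : is_derive t 1 (fun s => q (f s)) (q (df t)).
  by apply: qform_is_derive => u u0; exact: fdf.
apply: (@ger0_derive1_ndecr _ (fun s => q (f s)) t0 t1) => //.
- by move=> t; rewrite in_itv/= => tt; rewrite derive1E derive_val df0.
- by apply: derivable_within_continuous => t _.
Qed.

Lemma qform_increment_lim (f df : R -> R -> R) (g : R -> R) (t0 : R) :
  (forall t u : R, 0 <= u -> is_derive t 1 (f ^~ u) (df t u)) ->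
  (forall t, t0 < t -> 0 <= q (df t)) ->
  (forall u, 0 <= u -> f t u @[t --> +oo] --> g u) ->
  q (f t0) <= q g.
Proof.
move=> fdf df0 fg.
have cf : q (f t) @[t --> +oo] --> q g by exact: qform_cvg.
apply: ler_cvg_to (cvg_cst (q (f t0))) cf _.
near=> t; apply: (qform_increment (t0 := t0) (t1 := t) _ fdf).
  by near: t; apply: nbhs_pinfty_ge; exact: num_real.
by move=> s /andP[s0 _]; exact: df0.
Unshelve. all: by end_near. Qed.

(** One factor of the power is a sum over the coordinates of terms that can be
    absorbed in the coefficients b. *)
Lemma dot_power_ge0 (b : I -> R) (k : nat) :
  0 <= \sum_i \sum_j b i * b j * (\sum_l x i 0 l * x j 0 l) ^+ k.
Proof.
elim: k b => [|k IH] b.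
  rewrite (_ : (\sum_i _) = (\sum_i b i) ^+ 2) ?sqr_ge0//.
  rewrite expr2 mulr_suml; apply: eq_bigr => i _.
  by rewrite mulr_sumr; apply: eq_bigr => j _; rewrite expr0 mulr1.
rewrite (_ : (\sum_i _) = \sum_l \sum_i \sum_j (b i * x i 0 l) * (b j * x j 0 l) *
    (\sum_l x i 0 l * x j 0 l) ^+ k); first by apply: sumr_ge0 => l _; exact: IH.
rewrite [RHS]exchange_big/=; apply: eq_bigr => i _.
rewrite [RHS]exchange_big/=; apply: eq_bigr => j _.
rewrite exprS mulrA mulr_sumr mulr_suml; apply: eq_bigr => l _.
by ring.
Qed.

Lemma sqdistE (y z : 'rV[R]_p) : sqdist y z =
  \sum_l y 0 l ^+ 2 + \sum_l z 0 l ^+ 2 - 2 * \sum_l y 0 l * z 0 l.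
Proof.
rewrite /sqdist mulr_sumr -big_split/= -sumrB.
by apply: eq_bigr => l _; ring.
Qed.

(** Up to factors absorbed in the coefficients, a Gaussian kernel is the
    exponential of an inner product, hence a power series with nonnegative
    coefficients in it. *)
Lemma qform_gauss_ge0 (s : R) : 0 <= s -> 0 <= q (fun u => expR (- (s * u))).
Proof.
move=> s0.
pose N y := \sum_l (y : 'rV[R]_p) 0 l ^+ 2.
pose b i := a i * expR (- (s * N (x i))).
pose d i j := \sum_l x i 0 l * x j 0 l.
rewrite (_ : q _ = \sum_i \sum_j b i * b j * expR (2 * s * d i j)); last first.
  apply: eq_bigr => i _; apply: eq_bigr => j _.
  rewrite /b mulrACA -[RHS]mulrA -!expRD; congr (_ * expR _).
  by rewrite sqdistE /N /d; ring.
have cvgS : (\sum_i \sum_j b i * b j * series (exp_coeff (2 * s * d i j)) n)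
    @[n --> \oo] --> \sum_i \sum_j b i * b j * expR (2 * s * d i j).
  apply: cvg_sumT => i _; apply: cvg_sumT => j _; apply: cvgMl_tmp.
  exact: is_cvg_series_exp_coeff.
apply: ler_cvg_to (cvg_cst 0) cvgS _.
near=> n.
rewrite (_ : (\sum_i _) = \sum_(0 <= k < n) ((2 * s) ^+ k / k`!%:R) *
    \sum_i \sum_j b i * b j * (d i j) ^+ k); last first.
  under [RHS]eq_bigr do rewrite mulr_sumr.
  rewrite [RHS]exchange_big/=; apply: eq_bigr => i _.
  under [RHS]eq_bigr do rewrite mulr_sumr.
  rewrite [RHS]exchange_big/=; apply: eq_bigr => j _.
  rewrite /series/= mulr_sumr; apply: eq_bigr => k _.
  by rewrite /exp_coeff/= exprMn; ring.
apply: sumr_ge0 => k _; rewrite mulr_ge0 ?dot_power_ge0//.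
by rewrite mulr_ge0 ?exprn_ge0 ?mulr_ge0.
Unshelve. all: by end_near. Qed.

End gaussian_forms.

(** * The energy form as a mixture of Gaussian forms *)

Section laplace.
Context {R : realType}.

(** The integral of exp (- t (u + b)) over t > M. *)
Definition laplace_tail (b M u : R) : R := expR (- (M * (u + b))) / (u + b).

Lemma is_derive_laplace_tail (b M u : R) : 0 < b -> 0 <= u ->
  is_derive M 1 (fun M => laplace_tail b M u) (- (expR (- (M * b)) * expR (- (M * u)))).
Proof.
move=> b0 u0; rewrite -expRD.
have c0 : u + b != 0 by rewrite gt_eqF// ltr_wpDl.
rewrite (_ : (fun _ => _) = (u + b)^-1 \*: (expR \o (fun M => - (u + b) * M))); last first.
  by apply/funext => N; rewrite /laplace_tail/= mulrC mulNr [in LHS](mulrC N).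
apply: is_derive_eq.
rewrite /GRing.scale/= mulr1 (_ : - (u + b) * M = - (M * b) - M * u); last by ring.
by field.
Qed.

Lemma laplace_tail_cvg0 (b u : R) : 0 < b -> 0 <= u ->
  laplace_tail b M u @[M --> +oo] --> 0.
Proof.
move=> b0 u0; rewrite -(mul0r (u + b)^-1); apply: cvgMr_tmp.
have c0 : 0 < u + b by rewrite ltr_wpDl.
apply: (cvg_comp (fun M => M * (u + b)) (fun t => expR (- t)) _ (@cvgr_expR R)).
by apply: gt0_cvgMly => //; exact: cvg_id.
Qed.

Lemma laplace_tail0 (b u : R) : laplace_tail b 0 u = (u + b)^-1.
Proof. by rewrite /laplace_tail mul0r oppr0 expR0 mul1r. Qed.

Context {p : nat} (I : finType) (a : I -> R) (x : I -> 'rV[R]_p).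
Local Notation q := (qform a x).

Lemma qform_laplace_tail_decr (b M N : R) : 0 < b -> 0 <= M -> M <= N ->
  q (laplace_tail b N) <= q (laplace_tail b M).
Proof.
move=> b0 M0 MN; rewrite -lerN2 -!qformN.
apply: (qform_increment (f := fun t u => - laplace_tail b t u)
  (df := fun t u => expR (- (t * b)) * expR (- (t * u))) MN) => [t u u0|t /andP[Mt _]].
  by have := is_deriveN (is_derive_laplace_tail t b0 u0); rewrite opprK.
by rewrite qformZ mulr_ge0 ?expR_ge0// qform_gauss_ge0// (le_trans M0)// ltW.
Qed.

Lemma qform_laplace_tail_ge0 (b M : R) : 0 < b -> 0 <= M ->
  0 <= q (laplace_tail b M).
Proof.
move=> b0 M0; rewrite -lerN2 -qformN oppr0.
rewrite [leRHS](_ : 0 = q (fun=> 0)); last by rewrite qform_cst mul0r.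
apply: (qform_increment_lim (f := fun t u => - laplace_tail b t u)
  (df := fun t u => expR (- (t * b)) * expR (- (t * u)))) => [t u u0|t Mt|u u0].
- by have := is_deriveN (is_derive_laplace_tail t b0 u0); rewrite opprK.
- by rewrite qformZ mulr_ge0 ?expR_ge0// qform_gauss_ge0// (le_trans M0)// ltW.
- by rewrite -[0]oppr0; apply: cvgN; exact: laplace_tail_cvg0.
Qed.

Lemma qform_inv_decr (b c : R) : 0 < b -> b <= c ->
  q (fun u => (u + c)^-1) <= q (fun u => (u + b)^-1).
Proof.
move=> b0 bc; have c0 := lt_le_trans b0 bc.
rewrite -subr_le0 -qformB.
rewrite [leRHS](_ : 0 = q (fun=> 0)); last by rewrite qform_cst mul0r.
under eq_qform do rewrite -!laplace_tail0.
apply: (qform_increment_lim (f := fun t u => laplace_tail c t u - laplace_tail b t u)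
  (df := fun t u => (expR (- (t * b)) - expR (- (t * c))) * expR (- (t * u))))
  => [t u u0|t Mt|u u0].
- have := is_deriveB (is_derive_laplace_tail t c0 u0) (is_derive_laplace_tail t b0 u0).
  by congr is_derive; ring.
- rewrite qformZ; apply: mulr_ge0; last by rewrite qform_gauss_ge0// ltW.
  by rewrite subr_ge0 ler_expR lerN2 ler_pM2l.
- by rewrite -[0]subr0; apply: cvgB; exact: laplace_tail_cvg0.
Qed.

(** With r = sqrt u, the primitive r * atan (t / r) of u / (u + t^2) increases from
    0 to (pi / 2) r. For masses of total zero, - u / (u + t^2) has the same form as
    t^2 / (u + t^2), which for t <= 1 is at least the form of t^2 / (u + 1); the
    integral of t^2 over [0, 1] gives the factor 3. *)
Lemma qform_sqrt_dominates : \sum_i a i = 0 ->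
  q (fun u => (u + 1)^-1) <= 3 / 2 * pi * - q Num.sqrt.
Proof.
move=> a0.
have D (t u : R) : 0 <= u ->
    is_derive t 1 (fun t => - (Num.sqrt u * atan (t / Num.sqrt u))) (- (u / (u + t ^+ 2))).
  (* at u = 0 both functions vanish, by the convention x / 0 = 0 *)
  move=> u0; have [->|un0] := eqVneq u 0.
    rewrite sqrtr0 mul0r oppr0; under eq_fun do rewrite mul0r oppr0.
    exact: is_derive_cst.
  have r0 : Num.sqrt u != 0 by rewrite sqrtr_eq0 -ltNge lt_neqAle eq_sym un0.
  rewrite (_ : (fun _ => _) = - ( Num.sqrt u \*: (atan \o ((Num.sqrt u)^-1 \*: id))))//; last first.
    by apply/funext => s; rewrite /= /GRing.scale/= [in LHS](mulrC s).
  apply: is_derive_eq.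
  have ut : u + t ^+ 2 != 0 by rewrite gt_eqF// ltr_pwDl ?sqr_ge0// lt_neqAle eq_sym un0.
  rewrite /GRing.scale/= mulr1 exprMn exprVn sqr_sqrtr//.
  by field; rewrite r0 un0 ut.
have slope t : 0 < t ->
    q (fun u => - (u / (u + t ^+ 2))) = t ^+ 2 * q (fun u => (u + t ^+ 2)^-1).
  move=> t0; have E : q (fun=> 1) = 0 by rewrite qform_cst a0 expr0n mulr0.
  rewrite -qformZ -[LHS]addr0 -E -qformD; apply: eq_qform => u u0.
  have ut : u + t ^+ 2 != 0 by rewrite gt_eqF// ltr_wpDl// exprn_gt0.
  by field.
have upper : q (fun u => - (Num.sqrt u * atan (1 / Num.sqrt u))) <=
    pi / 2 * - q Num.sqrt.
  rewrite mulrN -mulNr -qformZ.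
  apply: (qform_increment_lim (f := fun t u => - (Num.sqrt u * atan (t / Num.sqrt u)))
      (df := fun t u => - (u / (u + t ^+ 2))) D)
    => [t t1|u u0].
  - have t0 : 0 < t by exact: lt_trans t1.
    rewrite slope// mulr_ge0 ?sqr_ge0//.
    under eq_qform do rewrite -laplace_tail0.
    by rewrite qform_laplace_tail_ge0// exprn_gt0.
  - rewrite mulNr mulrC; apply: cvgN; have [->|un0] := eqVneq u 0.
      by rewrite sqrtr0 mul0r; under eq_fun do rewrite mul0r; exact: cvg_cst.
    apply: cvgMl_tmp; apply: cvg_comp _ (@cvgy_atan R).
    apply: gt0_cvgMly; last exact: cvg_id.
    by rewrite invr_gt0 sqrtr_gt0 lt_neqAle eq_sym un0.
have lower : q (fun u => (u + 1)^-1) / 3 <=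
    q (fun u => - (Num.sqrt u * atan (1 / Num.sqrt u))).
  pose f t u : R := - (Num.sqrt u * atan (t / Num.sqrt u)) - t ^+ 3 / 3 * (u + 1)^-1.
  rewrite -subr_ge0 [in leRHS](mulrC _ 3^-1) -qformZ -qformB.
  rewrite [leRHS](_ : _ = q (f 1)); last first.
    by apply: eq_qform => u u0; rewrite /f expr1n !mul1r.
  rewrite [leLHS](_ : 0 = q (f 0)); last first.
    transitivity (q (fun=> 0)); first by rewrite qform_cst mul0r.
    apply: eq_qform => u u0.
    by rewrite /f mul0r atan0 expr0n/= !mul0r mulr0 subr0 oppr0.
  apply: (qform_increment (f := f) (df := fun t u => - (u / (u + t ^+ 2)) -
    t ^+ 2 * (u + 1)^-1)) => // [t u u0|t /andP[t0 t1]].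
    have P : is_derive t 1 (fun t : R => t ^+ 3 / 3 * (u + 1)^-1) (t ^+ 2 * (u + 1)^-1).
      rewrite (_ : (fun _ => _) = (3^-1 * (u + 1)^-1) \*: (fun t => t ^+ 3)); last first.
        by apply/funext => s; rewrite /=/GRing.scale/=; ring.
      apply: is_derive_eq; rewrite /GRing.scale/=.
      have u1 : u + 1 != 0 by rewrite gt_eqF// ltr_wpDl.
      by field.
    exact: (is_deriveB (D t u u0) P).
  rewrite qformB slope// qformZ -mulrBr mulr_ge0 ?sqr_ge0// subr_ge0.
  by apply: qform_inv_decr; rewrite ?exprn_gt0// exprn_ile1// ltW.
by lra.
Qed.
End laplace.

Section cauchy_schwarz.
Context {R : realType} {p : nat}.

Definition sum_fun (A B C : Type) (f : A -> C) (g : B -> C) (w : A + B) : C :=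
  match w with inl u => f u | inr v => g v end.

Lemma sum_sumType_sym (I J : finType) (U : I + J -> I + J -> R) :
  (forall u v, U u v = U v u) ->
  \sum_u \sum_v U u v = \sum_i \sum_i' U (inl i) (inl i') +
    \sum_j \sum_j' U (inr j) (inr j') + 2 * \sum_i \sum_j U (inl i) (inr j).
Proof.
move=> Usym; rewrite big_sumType/=.
under eq_bigr do rewrite big_sumType/=.
under [X in _ + X = _]eq_bigr do rewrite big_sumType/=.
rewrite !big_split/= [X in _ + (X + _)]exchange_big/=.
under [X in _ + (X + _)]eq_bigr do under eq_bigr do rewrite Usym.
by ring.
Qed.

Lemma qform_sum (I J : finType) (a : I -> R) (b : J -> R) (x : I -> 'rV[R]_p)
    (y : J -> 'rV[R]_p) (f : R -> R) :
  qform (sum_fun a b) (sum_fun x y) f = qform a x f + qform b y f +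
    2 * \sum_i \sum_j a i * b j * f (sqdist (x i) (y j)).
Proof.
rewrite /qform sum_sumType_sym// => u v.
by rewrite sqdistC (mulrC (sum_fun a b u)).
Qed.

(** Adding to the points x the point z with the mass that minimizes the form. *)
Lemma qform_cauchy_schwarz (f : R -> R) (I : finType) (a : I -> R)
    (x : I -> 'rV[R]_p) (z : 'rV[R]_p) :
  (forall (J : finType) (b : J -> R) (y : J -> 'rV[R]_p), 0 <= qform b y f) ->
  0 < f 0 -> (\sum_i a i * f (sqdist z (x i))) ^+ 2 <= f 0 * qform a x f.
Proof.
move=> psd f0; set g := \sum_i _.
(* the mass f 0 * a on x against the mass - g at z *)
have := psd _ (sum_fun (fun i => f 0 * a i) (fun _ : 'I_1 => - g)) (sum_fun x (fun=> z)).
rewrite qform_sum {2}/qform !big_ord1 sqdistxx.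
rewrite (_ : qform (fun i => f 0 * a i) x f = f 0 ^+ 2 * qform a x f); last first.
  rewrite /qform mulr_sumr; apply: eq_bigr => i _.
  by rewrite mulr_sumr; apply: eq_bigr => j _; ring.
rewrite (_ : \sum_i _ = - g * f 0 * g); last first.
  rewrite {3}/g mulr_sumr; apply: eq_bigr => i _.
  by rewrite big_ord1 sqdistC; ring.
rewrite (_ : _ + _ = f 0 * (f 0 * qform a x f - g ^+ 2)); last by ring.
by rewrite pmulr_rge0// subr_ge0.
Qed.

(** Membership in the reproducing kernel space of the kernel - |x - y|, in terms of
    finite measures of mass zero only. *)
Definition energy_dominated (f : 'rV[R]_p -> R) (C : R) : Prop :=
  forall (I : finType) (a : I -> R) (x : I -> 'rV[R]_p), \sum_i a i = 0 ->
  (\sum_i a i * f (x i)) ^+ 2 <= C * - \sum_i \sum_j a i * a j * norm2 (x i - x j).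

(** The integral of exp (- t (u + 1)) over s < t < s + h: for small h, a multiple of
    an approximate Gaussian exp (- s u). *)
Definition laplace_band (s h u : R) := laplace_tail 1 s u - laplace_tail 1 (s + h) u.

(** The band is positive semidefinite, and dominated as such by the whole mixture
    1 / (u + 1), itself dominated by the energy form. *)
Lemma laplace_band_dominated (s h : R) (z : 'rV[R]_p) : 0 < s -> 0 < h ->
  energy_dominated (fun y => laplace_band s h (sqdist z y))
    (laplace_band s h 0 * (3 / 2 * pi)).
Proof.
move=> s0 h0 I a x a0.
have sh0 : 0 <= s + h by rewrite addr_ge0// ltW.
have psd (J : finType) (b : J -> R) (y : J -> 'rV[R]_p) :
    0 <= qform b y (laplace_band s h).
  by rewrite qformB subr_ge0 qform_laplace_tail_decr// ?ltW// ltrDl.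
have b0 : 0 < laplace_band s h 0.
  by rewrite subr_gt0 /laplace_tail add0r divr1 mulr1 !mulr1 divr1 ltr_expR ltrN2 ltrDl.
apply: le_trans (qform_cauchy_schwarz a x z psd b0) _.
rewrite -mulrA ler_pM2l//.
rewrite (_ : \sum_i _ = qform a x Num.sqrt); last first.
  by apply: eq_bigr => i _; apply: eq_bigr => j _; rewrite norm2_sqdist.
apply: le_trans (qform_sqrt_dominates x a0).
under [leRHS]eq_qform do rewrite -laplace_tail0.
rewrite qformB (le_trans (y := qform a x (laplace_tail 1 s)))//.
  by rewrite gerBl qform_laplace_tail_ge0.
by rewrite qform_laplace_tail_decr// ltW.
Qed.

End cauchy_schwarz.

(** * Means and sampling by means *)

Section has_mean.
Context d {T : measurableType d} {R : realType} (mu : probability T R).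

Definition has_mean (f : T -> R) (v : R) :=
  mu.-integrable setT (EFin \o f) /\ \int[mu]_y f y = v.

Lemma has_meanE (f : T -> R) : mu.-integrable setT (EFin \o f) ->
  has_mean f (\int[mu]_y f y).
Proof. by []. Qed.

Lemma has_mean_cst c : has_mean (fun=> c) c.
Proof.
split; first exact: finite_measure_integrable_cst.
by rewrite Rintegral_cst// [X in fine X]probability_setT mulr1.
Qed.

Lemma has_meanD f g v w : has_mean f v -> has_mean g w ->
  has_mean (fun y => f y + g y) (v + w).
Proof.
move=> [fi <-] [gi <-]; split; last by rewrite RintegralD.
by apply: eq_integrable (integrableD _ fi gi) => // y _; rewrite /= EFinD.
Qed.

Lemma has_meanZ c f v : has_mean f v -> has_mean (fun y => c * f y) (c * v).
Proof.
move=> [fi <-]; split; last by rewrite RintegralZl.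
by apply: eq_integrable (integrableZl _ c fi) => // y _; rewrite /= EFinM.
Qed.

Lemma has_meanN f v : has_mean f v -> has_mean (fun y => - f y) (- v).
Proof.
move=> /(has_meanZ (-1)); rewrite mulN1r; congr has_mean.
by apply/funext => y; rewrite mulN1r.
Qed.

Lemma has_meanB f g v w : has_mean f v -> has_mean g w ->
  has_mean (fun y => f y - g y) (v - w).
Proof. by move=> fv gw; apply: has_meanD fv _; exact: has_meanN. Qed.

Lemma has_mean_sum (I : Type) (r : seq I) (P : pred I) (f : I -> T -> R) (v : I -> R) :
  (forall i, P i -> has_mean (f i) (v i)) ->
  has_mean (fun y => \sum_(i <- r | P i) f i y) (\sum_(i <- r | P i) v i).
Proof.
move=> fv; elim: r => [|i r IH].
  by rewrite big_nil; under eq_fun do rewrite big_nil; exact: has_mean_cst.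
rewrite big_cons; under eq_fun do rewrite big_cons.
by case: ifPn => // Pi; apply: has_meanD => //; exact: fv.
Qed.

Lemma has_mean_le f g v w : has_mean f v -> has_mean g w ->
  (forall y, f y <= g y) -> v <= w.
Proof. by move=> [fi <-] [gi <-] fg; apply: le_Rintegral. Qed.

Lemma has_mean_bounded (f : T -> R) c : measurable_fun setT f -> (forall y, `|f y| <= c) ->
  has_mean f (\int[mu]_y f y).
Proof.
move=> mf fc; apply: has_meanE; apply: measurable_bounded_integrable => //.
  by rewrite [ltLHS]probability_setT ltry.
by exists c; split; [exact: num_real|move=> b cb y _ /=; rewrite (le_trans (fc y))// ltW].
Qed.

(** Otherwise f - v would be positive almost everywhere with mean zero. *)
Lemma has_mean_exists_le (X : set T) f v : {ae mu, forall y, X y} ->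
  has_mean f v -> exists2 y, X y & f y <= v.
Proof.
move=> muX fv; apply: contrapT => /forall2NP no.
have [fi fE] := fv.
have pos : {ae mu, forall y, setT y -> 0 < f y - v}.
  apply: filterS muX => y Xy _; rewrite subr_gt0.
  by case: (no y) => // /negP; rewrite -ltNge.
have [gi g0] := has_meanB fv (has_mean_cst v).
have gz : (\int[mu]_y `|(f y - v)%:E| = 0)%E.
  have -> : (\int[mu]_y `|(f y - v)%:E| = \int[mu]_y (f y - v)%:E)%E.
    apply: ae_eq_integral => //.
    - exact: measurable_int (integrable_abse gi).
    - exact: measurable_int gi.
    - by apply: filterS pos => y p0 _; rewrite gee0_abs// lee_fin ltW// p0.
  move: g0; rewrite subrr /Rintegral => g0.
  by rewrite -[LHS]fineK ?g0//; exact: integrable_fin_num.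
have ae0 := (ae_eq_integral_abs mu measurableT (measurable_int _ gi)).1 gz.
have : {ae mu, forall y : T, False}.
  apply: filterS2 ae0 pos => y /= /(_ I)[->] /(_ I).
  by rewrite ltxx.
case=> N [mN N0 sN].
have : (mu setT <= mu N)%E by apply: le_measure; rewrite ?inE// => y _; apply: sN => /=; apply.
by rewrite probability_setT N0 lee_fin ler10.
Qed.

(** The mean over an independent sample of the left-hand side is the right-hand
    side, since k (x, .) has mean zero. Fixing the points one by one at values not
    above the conditional mean derandomizes this without product measures. *)
Lemma greedy_sample (X : set T) (k : T -> T -> R) (D : R) (I : finType)
    (W : I -> I -> R) (g : I -> T -> R) (c : I -> R) :
  {ae mu, forall y, X y} -> (forall x y, k x y = k y x) ->
  (forall x, X x -> has_mean (k x) 0) -> has_mean (fun y => k y y) D ->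
  (forall i, has_mean (g i) (c i)) -> (forall i j, W i j = W j i) ->
  exists2 y : I -> T, (forall i, X (y i)) &
    \sum_i \sum_j W i j * k (y i) (y j) + \sum_i g i (y i) <=
    \sum_i (W i i * D + c i).
Proof.
move=> muX ksym k0 kD gc Wsym.
suff : forall s : seq I, uniq s -> exists2 y : I -> T, (forall i, X (y i)) &
    \sum_(i <- s) \sum_(j <- s) W i j * k (y i) (y j) + \sum_(i <- s) g i (y i) <=
    \sum_(i <- s) (W i i * D + c i).
  by apply; exact: index_enum_uniq.
elim=> [_|i s IH /= /andP[Nis us]].
  have [x0 Xx0 _] := has_mean_exists_le muX (has_mean_cst 0).
  by exists (fun=> x0) => //; rewrite !big_nil addr0.
have [y Xy le_y] := IH us.
have [t Xt le_t] : exists2 t, X t &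
    (W i i * k t t + \sum_(j <- s) (2 * W i j) * k (y j) t) + g i t <=
    (W i i * D + \sum_(j <- s) (2 * W i j) * 0) + c i.
  apply: (has_mean_exists_le muX); apply: has_meanD => //; apply: has_meanD.
    exact: has_meanZ.
  by apply: has_mean_sum => j _; apply: has_meanZ; exact: k0.
pose y' l := if l == i then t else y l.
have y'i : y' i = t by rewrite /y' eqxx.
have y's l : l \in s -> y' l = y l.
  by rewrite /y'; case: eqP => // -> ; rewrite (negPf Nis).
exists y' => [l|]; first by rewrite /y'; case: ifP.
have inner l : \sum_(j <- i :: s) W l j * k (y' l) (y' j) =
    W l i * k (y' l) t + \sum_(j <- s) W l j * k (y' l) (y j).
  by rewrite big_cons y'i; congr (_ + _); apply: eq_big_seq => j js; rewrite (y's j).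
rewrite (eq_bigr _ (fun l _ => inner l)) !big_cons y'i.
have -> : \sum_(l <- s) (W l i * k (y' l) t + \sum_(j <- s) W l j * k (y' l) (y j)) =
    \sum_(j <- s) W i j * k (y j) t + \sum_(l <- s) \sum_(j <- s) W l j * k (y l) (y j).
  by rewrite -big_split/=; apply: eq_big_seq => l ls; rewrite y's// Wsym.
have -> : \sum_(l <- s) g l (y' l) = \sum_(l <- s) g l (y l).
  by apply: eq_big_seq => l ls; rewrite y's.
have -> : \sum_(j <- s) W i j * k t (y j) = \sum_(j <- s) W i j * k (y j) t.
  by apply: eq_bigr => j _; rewrite ksym.
have E2 : \sum_(j <- s) (2 * W i j) * k (y j) t = 2 * \sum_(j <- s) W i j * k (y j) t.
  by rewrite mulr_sumr; apply: eq_bigr => j _; rewrite mulrA.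
have E0 : \sum_(j <- s) (2 * W i j) * 0 = 0 :> R by rewrite big1// => j _; rewrite mulr0.
by rewrite E2 E0 in le_t; lra.
Qed.

End has_mean.

(** * The energy distance as a centred quadratic form *)

Lemma sum_cst (R : pzRingType) (I : finType) (c : R) : \sum_(i : I) c = #|I|%:R * c.
Proof. by rewrite sumr_const mulr_natl. Qed.

Section energy.
Context {R : realType} {p : nat} (mu : probability (borel_rV R p) R).
Variables (X : set 'rV[R]_p).
Hypotheses (muX : {ae mu, forall y, X y}) (fe : finite_energy mu X).

Definition potential (x : 'rV[R]_p) : R := \int[mu]_y norm2 (x - y).

Definition mean_dist : R := \int[(mu \x mu)%E]_z norm2 (z.1 - z.2).

Lemma norm2C (x y : 'rV[R]_p) : norm2 (x - y) = norm2 (y - x).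
Proof. by rewrite !norm2_sqdist sqdistC. Qed.

Lemma norm2xx (x : 'rV[R]_p) : norm2 (x - x) = 0.
Proof. by rewrite norm2_sqdist sqdistxx sqrtr0. Qed.

Lemma has_mean_dist x : X x -> has_mean mu (fun y => norm2 (x - y)) (potential x).
Proof. by move=> Xx; apply: has_meanE; exact: (proj1 fe). Qed.

(** Fubini only makes the inner integral finite almost everywhere, whence the
    detour through [fine]. *)
Lemma has_mean_potential : has_mean mu potential mean_dist.
Proof.
have [_ ie] := fe.
have iF := integrable_fubini_F ie.
have mF := measurable_int _ iF.
have mh : measurable_fun setT (potential : borel_rV R p -> R).
  rewrite (_ : potential = fine \o fubini_F mu
    (fun z : borel_rV R p * borel_rV R p => (norm2 (z.1 - z.2))%:E))//.
  have mfine : measurable_fun setT (@fine R) by [].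
  exact: (measurableT_comp mfine mF).
have ih : mu.-integrable setT (fun x : borel_rV R p => (potential x)%:E).
  apply: le_integrable iF => //; first exact/measurable_EFinP.
  move=> x _; rewrite /potential /Rintegral /fubini_F/=.
  by case: (\int[mu]_y _)%E => //= ; rewrite normr0 leey.
split=> //; congr fine; rewrite -(integral12_prod_meas1 ie).
apply: ae_eq_integral => //; first exact/measurable_EFinP.
apply: filterS (integrable_ae measurableT iF) => x /= /(_ I) xfin _.
by rewrite fineK.
Qed.

(** The kernel - |x - y|, made orthogonal to the constants in both variables. *)
Definition centered_dist (x y : 'rV[R]_p) : R :=
  potential x + potential y - norm2 (x - y) - mean_dist.

Lemma centered_distC x y : centered_dist x y = centered_dist y x.
Proof. by rewrite /centered_dist norm2C (addrC (potential x)). Qed.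

Lemma has_mean_centered_dist x : X x -> has_mean mu (centered_dist x) 0.
Proof.
move=> Xx; rewrite (_ : 0 = potential x + mean_dist - potential x - mean_dist); last by ring.
apply: has_meanB (has_mean_cst _ _); apply: has_meanB (has_mean_dist Xx).
by apply: has_meanD (has_mean_cst _ _) has_mean_potential.
Qed.

Lemma has_mean_centered_diag : has_mean mu (fun y => centered_dist y y) mean_dist.
Proof.
rewrite {1}(_ : mean_dist = mean_dist + mean_dist - 0 - mean_dist); last by ring.
apply: has_meanB (has_mean_cst _ _); apply: has_meanB.
  by apply: has_meanD; exact: has_mean_potential.
by under eq_fun do rewrite norm2xx; exact: has_mean_cst.
Qed.

Lemma energyE (I : finType) (x : I -> 'rV[R]_p) : (0 < #|I|)%N ->
  energy mu x = (#|I|%:R ^+ 2)^-1 * \sum_i \sum_j centered_dist (x i) (x j).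
Proof.
move=> I0; have n0 : #|I|%:R != 0 :> R by rewrite pnatr_eq0 -lt0n.
have -> : \sum_i \sum_j centered_dist (x i) (x j) =
    2 * #|I|%:R * (\sum_i potential (x i)) -
    \sum_i \sum_j norm2 (x i - x j) - #|I|%:R ^+ 2 * mean_dist.
  under eq_bigr do rewrite /centered_dist !sumrB big_split/= !sum_cst.
  by rewrite !sumrB big_split/= !sum_cst -mulr_sumr; ring.
by rewrite /energy -/mean_dist /potential; field.
Qed.

(** The kernel k = C * centered_dist - (f - v)(f - v) is nonnegative on finite
    measures of mass zero. Applied to the empirical measure of x minus that of N
    greedily sampled points, this says that the double mean of k over x is at least
    - D / N, where D is the mean of k on the diagonal; let N tend to infinity. *)
Lemma energy_dominated_le (f : 'rV[R]_p -> R) (C c v : R) (I : finType)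
    (x : I -> 'rV[R]_p) :
  energy_dominated f C -> has_mean mu f v -> has_mean mu (fun y => f y ^+ 2) c ->
  (0 < #|I|)%N -> (forall i, X (x i)) ->
  ((\sum_i f (x i)) / #|I|%:R - v) ^+ 2 <= C * energy mu x.
Proof.
move=> fC fv f2c I0 Xx.
pose k y z := C * centered_dist y z - (f y - v) * (f z - v).
have kC y z : k y z = k z y by rewrite /k centered_distC (mulrC (f y - v)).
have k0 y : X y -> has_mean mu (k y) 0.
  move=> Xy; rewrite (_ : 0 = C * 0 - (f y - v) * (v - v)); last by rewrite subrr !mulr0 subr0.
  apply: has_meanB; first by apply: has_meanZ; exact: has_mean_centered_dist.
  by apply: has_meanZ; apply: has_meanB fv _; exact: has_mean_cst.
pose D := C * mean_dist - (c - (2 * v) * v + v ^+ 2).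
have kD : has_mean mu (fun y => k y y) D.
  apply: has_meanB; first by apply: has_meanZ; exact: has_mean_centered_diag.
  rewrite (_ : (fun y => _) = fun y => f y ^+ 2 - (2 * v) * f y + v ^+ 2); last first.
    by apply/funext => y; ring.
  apply: has_meanD (has_mean_cst _ _); apply: has_meanB => //.
  exact: has_meanZ.
have n0 : #|I|%:R != 0 :> R by rewrite pnatr_eq0 -lt0n.
have kform (J : finType) (a : J -> R) (y : J -> 'rV[R]_p) : \sum_j a j = 0 ->
    0 <= \sum_i \sum_j a i * a j * k (y i) (y j).
  move=> a0.
  have -> : \sum_i \sum_j a i * a j * k (y i) (y j) =
      C * - (\sum_i \sum_j a i * a j * norm2 (y i - y j)) -
      (\sum_i a i * f (y i)) ^+ 2.
    have inner i : \sum_j a i * a j * k (y i) (y j) =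
        (C * (potential (y i) - mean_dist) + (f (y i) - v) * v) * a i * (\sum_j a j) +
        C * a i * (\sum_j a j * potential (y j)) -
        C * (\sum_j a i * a j * norm2 (y i - y j)) -
        a i * (f (y i) - v) * (\sum_j a j * f (y j)).
      rewrite !mulr_sumr -big_split/= -!sumrB; apply: eq_bigr => j _.
      by rewrite /k /centered_dist; ring.
    rewrite (eq_bigr _ (fun i _ => inner i)) a0 !sumrB.
    under [X in X - _ - _]eq_bigr do rewrite mulr0 add0r.
    rewrite -!mulr_suml -!mulr_sumr a0.
    rewrite (_ : \sum_i a i * (f (y i) - v) = \sum_i a i * f (y i)); first by ring.
    under eq_bigr do rewrite mulrBr.
    by rewrite sumrB -mulr_suml a0 mul0r subr0.
  by rewrite subr_ge0; exact: fC.
have nE : C * energy mu x - ((\sum_i f (x i)) / #|I|%:R - v) ^+ 2 =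
    \sum_i \sum_j #|I|%:R^-1 * #|I|%:R^-1 * k (x i) (x j).
  rewrite (energyE x I0).
  have inner i : \sum_j #|I|%:R^-1 * #|I|%:R^-1 * k (x i) (x j) =
      #|I|%:R^-1 * #|I|%:R^-1 * (C * \sum_j centered_dist (x i) (x j) -
        (f (x i) - v) * ((\sum_j f (x j)) - #|I|%:R * v)).
    rewrite -mulr_sumr; congr (_ * _).
    rewrite sumrB -mulr_sumr; congr (_ - _).
    by rewrite -mulr_sumr sumrB sum_cst.
  rewrite (eq_bigr _ (fun i _ => inner i)) -mulr_sumr sumrB -mulr_sumr -mulr_suml.
  by rewrite sumrB sum_cst; field.
rewrite -subr_ge0 nE; set S := \sum_i _.
have sample N : (0 < N)%N -> - S <= D / N%:R.
  move=> N0; have N0' : N%:R != 0 :> R by rewrite pnatr_eq0 -lt0n.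
  pose g (j : 'I_N) y := (- 2 * (#|I|%:R^-1 * N%:R^-1)) * \sum_i k (x i) y.
  have g0 j : has_mean mu (g j) 0.
    have sum0 : has_mean mu (fun y => \sum_i k (x i) y) (\sum_(i : I) 0).
      by apply: has_mean_sum => i _; exact: k0.
    rewrite big1_eq in sum0.
    by have := has_meanZ (- 2 * (#|I|%:R^-1 * N%:R^-1)) sum0; rewrite mulr0.
  have [y Xy le_y] := greedy_sample (W := fun _ _ : 'I_N => N%:R^-1 * N%:R^-1)
    muX kC k0 kD g0 (fun _ _ => erefl).
  have a0 : \sum_u sum_fun (fun _ : I => #|I|%:R^-1 : R) (fun _ : 'I_N => - N%:R^-1) u = 0.
    rewrite big_sumType/= !sum_cst card_ord.
    by field; rewrite n0 N0'.
  have := kform _ _ (sum_fun x y) a0.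
  rewrite sum_sumType_sym/=; last by move=> u w; rewrite kC (mulrC (sum_fun _ _ u)).
  rewrite -/S.
  have gE : \sum_i g i (y i) =
      2 * \sum_i \sum_j #|I|%:R^-1 * (- N%:R^-1) * k (x i) (y j).
    rewrite [in RHS]exchange_big/= mulr_sumr; apply: eq_bigr => j _.
    by rewrite /g -mulr_sumr; ring.
  have WE : \sum_(i < N) (N%:R^-1 * N%:R^-1 * D + 0) = D / N%:R.
    by rewrite sum_cst card_ord addr0; field.
  have sgn : \sum_(j < N) \sum_(l < N) - N%:R^-1 * - N%:R^-1 * k (y j) (y l) =
      \sum_j \sum_l N%:R^-1 * N%:R^-1 * k (y j) (y l).
    by apply: eq_bigr => j _; apply: eq_bigr => l _; rewrite mulrNN.
  by rewrite gE WE in le_y; rewrite sgn => ?; lra.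
have lim : D / n.+1%:R @[n --> \oo] --> 0.
  by rewrite -(mulr0 D); apply: cvgMl_tmp; exact: cvg_harmonic.
rewrite -oppr_le0; apply: ler_cvg_to (cvg_cst (- S)) lim _.
by near=> n; exact: sample.
Unshelve. all: by end_near. Qed.
End energy.

(** * Functions whose averages converge *)

Section test_functions.
Context {R : realType} {p : nat}.

Lemma sqdist_continuous (z : 'rV[R]_p) : continuous (sqdist z).
Proof.
move=> y; apply: (@cvg_sumT _ _ (nbhs y) (nbhs_filter y)) => j _.
rewrite expr2; under eq_fun do rewrite expr2.
have c : (z 0 j - y' 0 j) @[y' --> y] --> (z 0 j - y 0 j).
  by apply: (@cvgB _ _ _ (nbhs y)); [exact: cvg_cst|exact: coord_continuous].
exact: (@cvgM _ _ (nbhs y)).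
Qed.

Lemma continuous_borel_measurable (f : 'rV[R]_p -> R) : continuous f ->
  measurable_fun setT (f : borel_rV R p -> R).
Proof.
move=> /continuousP cf; apply: (measurability _ (RGenOpens.measurableE R)).
move=> _ [_ [a [b ->] <-]]; rewrite setTI; apply: sub_sigma_algebra.
exact/cf/interval_open.
Qed.

Lemma laplace_tail_le1 (M u : R) : 0 <= M -> 0 <= u -> 0 <= laplace_tail 1 M u <= 1.
Proof.
move=> M0 u0; have u1 : 0 < u + 1 by rewrite ltr_wpDl.
rewrite /laplace_tail divr_ge0 ?expR_ge0 ?(ltW u1)//= ler_pdivrMr// mul1r.
rewrite (@le_trans _ _ 1) ?lerDr// expR_le1 oppr_le0 mulr_ge0// ltW//.
Qed.

Lemma laplace_band_bound (s h u : R) : 0 <= s -> 0 <= h -> 0 <= u ->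
  `|laplace_band s h u| <= 1.
Proof.
move=> s0 h0 u0; rewrite /laplace_band ler_norml.
have /andP[a0 a1] := laplace_tail_le1 s0 u0.
have /andP[b0 b1] := laplace_tail_le1 (addr_ge0 s0 h0) u0.
by lra.
Qed.

Lemma laplace_band_continuous (s h : R) (z : 'rV[R]_p) :
  continuous (fun y => laplace_band s h (sqdist z y)).
Proof.
have tail M : continuous (fun y => laplace_tail 1 M (sqdist z y)).
  move=> y; have cy : sqdist z y' + 1 @[y' --> y] --> sqdist z y + 1.
    by apply: (@cvgD _ _ _ (nbhs y)); [exact: sqdist_continuous|exact: cvg_cst].
  rewrite /laplace_tail; apply: (@cvgM _ _ (nbhs y)); last first.
    by apply: (@cvgV _ _ (nbhs y)) cy; rewrite gt_eqF// ltr_wpDl// sqdist_ge0.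
  have cN : - (M * (sqdist z y' + 1)) @[y' --> y] --> - (M * (sqdist z y + 1)).
    by apply: (@cvgN _ _ _ (nbhs y)); apply: (@cvgMl_tmp _ _ (nbhs y)).
  exact: (cvg_comp _ _ cN (@continuous_expR R _)).
by move=> y; apply: (@cvgB _ _ _ (nbhs y)); exact: tail.
Qed.

(** This is |(1 - exp (- t)) / t - 1| <= t for t = h (u + 1), together with
    s (u + 1) exp (- s (u + 1)) <= 1. *)
Lemma laplace_band_approx (s h u : R) : 0 < s -> 0 < h -> 0 <= u ->
  `|h^-1 * laplace_band s h u - expR (- (s * (u + 1)))| <= h / s.
Proof.
move=> s0 h0 u0; rewrite /laplace_band /laplace_tail.
have U0 : 0 < u + 1 by rewrite ltr_wpDl.
move: (u + 1) U0 => U U0.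
rewrite mulrDl opprD expRD; set E := expR (- (s * U)).
set t := h * U; have t0 : 0 < t by exact: mulr_gt0.
have t1 : 0 < 1 + t by rewrite addr_gt0.
have lo : 1 - t <= expR (- t) by rewrite expR_ge1Dx.
have hi : expR (- t) <= (1 + t)^-1.
  by rewrite expRN lef_pV2 ?posrE ?expR_gt0// expR_ge1Dx.
have hi' : expR (- t) <= 1 - t + t ^+ 2.
  apply: le_trans hi _; rewrite -[leLHS]mul1r ler_pdivrMr//.
  rewrite -subr_ge0 (_ : _ - _ = t ^+ 3); last by ring.
  by rewrite exprn_ge0// ltW.
have -> : h^-1 * (E / U - E * expR (- t) / U) - E = E * ((1 - expR (- t)) / t - 1).
  by rewrite /t; field; rewrite !gt_eqF.
have E0 : 0 < E := expR_gt0 _.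
have Es : E * t <= h / s.
  have : E * (1 + s * U) <= 1.
    by rewrite /E expRN mulrC ler_pdivrMr ?expR_gt0// mul1r expR_ge1Dx.
  rewrite /t ler_pdivlMr//; nra.
apply: le_trans Es; rewrite normrM (gtr0_norm E0) ler_pM2l// ler_norml.
apply/andP; split.
  by rewrite lerBrDr ler_pdivlMr//; nra.
by rewrite lerBlDr ler_pdivrMr//; nra.
Qed.

End test_functions.

Section gauss_alg.
Context {R : realType} {p : nat}.

(** Expanding the square in a Gaussian turns its centre into the linear form w;
    in this presentation the closure under products is immediate. *)
Inductive gauss_alg : ('rV[R]_p -> R) -> Prop :=
| gauss_alg_cst c : gauss_alg (fun=> c)
| gauss_alg_exp (a : R) (w : 'rV[R]_p) : 0 < a ->
    gauss_alg (fun y => expR (\sum_j w 0 j * y 0 j - a * \sum_j y 0 j ^+ 2))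
| gauss_algZ c f : gauss_alg f -> gauss_alg (fun y => c * f y)
| gauss_algD f g : gauss_alg f -> gauss_alg g -> gauss_alg (fun y => f y + g y).

Lemma eq_gauss_alg f g : f =1 g -> gauss_alg f -> gauss_alg g.
Proof. by move=> /funext ->. Qed.

Lemma gauss_algM f g : gauss_alg f -> gauss_alg g -> gauss_alg (fun y => f y * g y).
Proof.
move=> gf; elim: gf g => {f} [c g gg|a w a0 g|c f _ IH g /IH|f1 f2 _ IH1 _ IH2 g gg].
- exact: gauss_algZ.
- elim=> {g} [c|b v b0|c g _ /(gauss_algZ c)|g1 g2 _ IH1 _ IH2].
  + apply: eq_gauss_alg (gauss_algZ c (gauss_alg_exp w a0)) => y.
    by rewrite mulrC.
  + apply: eq_gauss_alg (gauss_alg_exp (w + v) (addr_gt0 a0 b0)) => y.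
    rewrite -expRD; congr expR.
    have -> : \sum_j (w + v) 0 j * y 0 j =
        \sum_j w 0 j * y 0 j + \sum_j v 0 j * y 0 j.
      by rewrite -big_split; apply: eq_bigr => j _; rewrite mxE mulrDl.
    by ring.
  + by apply: eq_gauss_alg => y; rewrite mulrCA.
  + by apply: eq_gauss_alg (gauss_algD IH1 IH2) => y; rewrite mulrDr.
- by move=> /(gauss_algZ c); apply: eq_gauss_alg => y; rewrite mulrA.
- by apply: eq_gauss_alg (gauss_algD (IH1 _ gg) (IH2 _ gg)) => y; rewrite mulrDl.
Qed.

Lemma gauss_alg_gauss (a : R) (z : 'rV[R]_p) : 0 < a ->
  gauss_alg (fun y => expR (- (a * sqdist z y))).
Proof.
move=> a0.
apply: eq_gauss_alg (gauss_algZ (expR (- (a * \sum_j z 0 j ^+ 2)))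
  (gauss_alg_exp ((2 * a) *: z) a0)) => y.
rewrite -expRD; congr expR.
have -> : \sum_j ((2 * a) *: z) 0 j * y 0 j = (2 * a) * \sum_j z 0 j * y 0 j.
  by rewrite mulr_sumr; apply: eq_bigr => j _; rewrite mxE mulrA.
by rewrite sqdistE; ring.
Qed.

Lemma gauss_algB1 f : gauss_alg f -> gauss_alg (fun y => 1 - f y).
Proof.
move=> gf; apply: eq_gauss_alg (gauss_algD (gauss_alg_cst 1) (gauss_algZ (-1) gf)) => y.
by rewrite mulN1r.
Qed.

Lemma gauss_algX f n : gauss_alg f -> gauss_alg (fun y => f y ^+ n).
Proof.
move=> gf; elim: n => [|n IH]; first exact: gauss_alg_cst.
by apply: eq_gauss_alg (gauss_algM gf IH) => y; rewrite exprS.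
Qed.

Lemma gauss_alg_prod (I : Type) (s : seq I) (f : I -> 'rV[R]_p -> R) :
  (forall i, gauss_alg (f i)) -> gauss_alg (fun y => \prod_(i <- s) f i y).
Proof.
move=> gf; elim: s => [|i s IH].
  by apply: eq_gauss_alg (gauss_alg_cst 1) => y; rewrite big_nil.
by apply: eq_gauss_alg (gauss_algM (gf i) IH) => y; rewrite big_cons.
Qed.

Context (mu : probability (borel_rV R p) R) (X : set 'rV[R]_p).
Hypotheses (muX : {ae mu, forall y, X y}) (fe : finite_energy mu X).
Context (I : nat -> finType) (x : forall n, I n -> 'rV[R]_p).
Hypothesis xX : \forall n \near \oo, (0 < #|I n|)%N /\ forall i, X (@x n i).
Hypothesis energy0 : energy mu (@x n) @[n --> \oo] --> 0.

Definition avg (n : nat) (f : 'rV[R]_p -> R) : R := (\sum_i f (@x n i)) / #|I n|%:R.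

Definition avg_cvg (f : 'rV[R]_p -> R) : Prop :=
  exists2 v, has_mean mu f v & avg n f @[n --> \oo] --> v.

Lemma avg_cst n c : (0 < #|I n|)%N -> avg n (fun=> c) = c.
Proof.
by move=> n0; rewrite /avg sum_cst mulrAC divff ?mul1r// pnatr_eq0 -lt0n.
Qed.

Lemma avgD n f g : avg n (fun y => f y + g y) = avg n f + avg n g.
Proof. by rewrite /avg big_split/= mulrDl. Qed.

Lemma avgZ n c f : avg n (fun y => c * f y) = c * avg n f.
Proof. by rewrite /avg -mulr_sumr mulrA. Qed.

Lemma avg_le n f g : (forall y, f y <= g y) -> avg n f <= avg n g.
Proof. by move=> fg; rewrite ler_wpM2r ?invr_ge0// ler_sum. Qed.

Lemma avg_cvg_cst c : avg_cvg (fun=> c).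
Proof.
exists c; first exact: has_mean_cst.
apply/cvgrPdist_le => e e0; near=> n.
have [n0 _] : (0 < #|I n|)%N /\ forall i, X (@x n i) by near: n.
by rewrite avg_cst// subrr normr0 ltW.
Unshelve. all: by end_near. Qed.

Lemma avg_cvgD f g : avg_cvg f -> avg_cvg g -> avg_cvg (fun y => f y + g y).
Proof.
move=> [v fv fc] [w gw gc]; exists (v + w); first exact: has_meanD.
by under eq_fun do rewrite avgD; exact: cvgD.
Qed.

Lemma avg_cvgZ c f : avg_cvg f -> avg_cvg (fun y => c * f y).
Proof.
move=> [v fv fc]; exists (c * v); first exact: has_meanZ.
by under eq_fun do rewrite avgZ; exact: cvgMl_tmp.
Qed.

Lemma avg_cvg_uniform_limit f v : has_mean mu f v ->
  (forall e, 0 < e -> exists2 g, avg_cvg g & forall y, `|f y - g y| <= e) ->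
  avg_cvg f.
Proof.
move=> fv approx; exists v => //; apply/cvgrPdist_le => e e0.
have e3 : 0 < e / 3 by rewrite divr_gt0.
have [g [w gw gc] fg] := approx _ e3.
have up y : f y <= g y + e / 3 by have := fg y; rewrite ler_norml; lra.
have lo y : g y + - (e / 3) <= f y by have := fg y; rewrite ler_norml; lra.
have vw1 := has_mean_le fv (has_meanD gw (has_mean_cst mu (e / 3))) up.
have vw2 := has_mean_le (has_meanD gw (has_mean_cst mu (- (e / 3)))) fv lo.
have near_g : \forall n \near \oo, `|w - avg n g| <= e / 3.
  by move/cvgrPdist_le : gc; exact.
near=> n.
have [n0 _] : (0 < #|I n|)%N /\ forall i, X (@x n i) by near: n.
have := avg_le n up; rewrite avgD avg_cst// => a1.
have := avg_le n lo; rewrite avgD avg_cst// => a2.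
have : `|w - avg n g| <= e / 3 by near: n.
by rewrite !ler_norml => /andP[b1 b2]; apply/andP; split; lra.
Unshelve. all: by end_near. Qed.

(** The squared discrepancy of f is at most C times an energy that tends to 0. *)
Lemma avg_cvg_dominated f C c : energy_dominated f C ->
  measurable_fun setT (f : borel_rV R p -> R) ->
  (forall y, `|f y| <= c) -> avg_cvg f.
Proof.
move=> fC mf fc.
have hf := has_mean_bounded mu mf fc.
have hf2 : has_mean mu (fun y => f y ^+ 2) (\int[mu]_y (f y ^+ 2)).
  apply: (@has_mean_bounded _ _ _ _ _ (c ^+ 2)).
    exact: (measurable_funX 2 mf).
  move=> y; rewrite normrX lerXn2r ?nnegrE//; exact: le_trans (fc y).
exists (\int[mu]_y f y) => //.
have sq : \forall n \near \oo, (avg n f - \int[mu]_y f y) ^+ 2 <= C * energy mu (@x n).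
  apply: filterS xX => n [n0 Xx]; exact: (energy_dominated_le muX fe fC hf hf2 n0 Xx).
have C0 : C * energy mu (@x n) @[n --> \oo] --> 0.
  by rewrite -(mulr0 C); exact: cvgMl_tmp.
apply/cvgrPdist_le => e e0.
have small : \forall n \near \oo, C * energy mu (@x n) <= e ^+ 2.
  by apply: (cvgr_le _ C0); rewrite exprn_gt0.
near=> n.
have h1 : (avg n f - \int[mu]_y f y) ^+ 2 <= C * energy mu (@x n) by near: n.
have h2 : C * energy mu (@x n) <= e ^+ 2 by near: n.
rewrite distrC -(@ler_pXn2r _ 2)// ?nnegrE ?(ltW e0)//.
by rewrite -normrX (le_trans _ h2)// (le_trans _ h1)// ger0_norm ?sqr_ge0.
Unshelve. all: by end_near. Qed.

(** Divided by their width h, the bands at s converge uniformly to a multiple of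
    the Gaussian when h tends to 0. *)
Lemma avg_cvg_gauss (s : R) (z : 'rV[R]_p) : 0 < s ->
  avg_cvg (fun y => expR (- (s * sqdist z y))).
Proof.
move=> s0.
have shifted : avg_cvg (fun y => expR (- (s * (sqdist z y + 1)))).
  have mean := has_mean_bounded mu (f := fun y => expR (- (s * (sqdist z y + 1)))) (c := 1).
  apply: avg_cvg_uniform_limit.
    apply: mean.
      apply: continuous_borel_measurable => y.
      have cN : - (s * (sqdist z y' + 1)) @[y' --> y] --> - (s * (sqdist z y + 1)).
        apply: (@cvgN _ _ _ (nbhs y)); apply: (@cvgMl_tmp _ _ (nbhs y)).
        by apply: (@cvgD _ _ _ (nbhs y)); [exact: sqdist_continuous|exact: cvg_cst].
      exact: (cvg_comp _ _ cN (@continuous_expR R _)).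
    move=> y; rewrite ger0_norm ?expR_ge0// expR_le1 oppr_le0 mulr_ge0 ?(ltW s0)//.
    by rewrite addr_ge0 ?sqdist_ge0.
  move=> e e0; have h0 : 0 < e * s by exact: mulr_gt0.
  exists (fun y => (e * s)^-1 * laplace_band s (e * s) (sqdist z y)).
    apply: avg_cvgZ; apply: (avg_cvg_dominated (laplace_band_dominated z s0 h0) (c := 1)).
      by apply: continuous_borel_measurable; exact: laplace_band_continuous.
    by move=> y; rewrite laplace_band_bound ?sqdist_ge0// ltW.
  move=> y; rewrite distrC; apply: le_trans (laplace_band_approx s0 h0 (sqdist_ge0 z y)) _.
  by rewrite mulfK// gt_eqF.
have := avg_cvgZ (expR s) shifted; congr avg_cvg; apply/funext => y.
by rewrite -expRD; congr expR; ring.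
Qed.

Lemma avg_cvg_gauss_alg f : gauss_alg f -> avg_cvg f.
Proof.
elim=> {f} [c|a w a0|c f _|f g _ + _].
- exact: avg_cvg_cst.
- have := avg_cvgZ (expR (a * \sum_j ((2 * a)^-1 *: w) 0 j ^+ 2))
    (avg_cvg_gauss ((2 * a)^-1 *: w) a0).
  congr avg_cvg; apply/funext => y; rewrite -expRD; congr expR.
  rewrite sqdistE.
  have -> : \sum_j ((2 * a)^-1 *: w) 0 j * y 0 j = (2 * a)^-1 * \sum_j w 0 j * y 0 j.
    by rewrite mulr_sumr; apply: eq_bigr => j _; rewrite mxE mulrA.
  by field; rewrite gt_eqF.
- exact: avg_cvgZ.
- exact: avg_cvgD.
Qed.

End gauss_alg.

(** * Half-spaces as limits of balls *)

Section halfspace.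
Context {R : realType} {p : nat}.

(** The open half-space is s * (y_j - t_j) < 0, with s = 1 or s = -1. The centre lies
    inside it at distance u^2 + 1 / u from t, where u = k + 1; the ball of radius u^2
    around it thus stays 1 / u away from the boundary. *)
Definition halfspace_centre (s : R) (t : 'rV[R]_p) (j : 'I_p) (k : nat) : 'rV[R]_p :=
  t - (s * (k.+1%:R ^+ 2 + k.+1%:R^-1)) *: delta_mx 0 j.

(** The exponent is about exp (u^4), so that the power is close to 0 well inside
    the ball of radius u^2 and close to 1 well outside. *)
Definition halfspace_approx (s : R) (t : 'rV[R]_p) (j : 'I_p) (k : nat)
    (y : 'rV[R]_p) : R :=
  1 - (1 - expR (- sqdist (halfspace_centre s t j k) y))
    ^+ Num.truncn (expR ((k.+1%:R : R) ^+ 4)).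

Variables (s : R) (t : 'rV[R]_p) (j : 'I_p).
Hypothesis s1 : s ^+ 2 = 1.
Local Notation hs := (halfspace_approx s t j).

Lemma sqdist_halfspace_centre k (y : 'rV[R]_p) : let d := k.+1%:R ^+ 2 + k.+1%:R^-1 in
  sqdist (halfspace_centre s t j k) y =
  sqdist t y + 2 * d * (s * (y 0 j - t 0 j)) + d ^+ 2.
Proof.
move=> d; rewrite /sqdist (bigD1 j)//= [in RHS](bigD1 j)//=.
rewrite !mxE !eqxx -/d.
have -> : \sum_(i < p | i != j) (halfspace_centre s t j k 0 i - y 0 i) ^+ 2 =
    \sum_(i < p | i != j) (t 0 i - y 0 i) ^+ 2.
  apply: eq_bigr => i ij; rewrite !mxE eqxx/= (negPf ij) mulr0 subr0//.
set S := \sum_(i < p | _) _.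
rewrite (_ : _ ^+ 2 = (t 0 j - y 0 j) ^+ 2 + 2 * d * (s * (y 0 j - t 0 j)) + s ^+ 2 * d ^+ 2).
  by rewrite s1; ring.
by rewrite mulr1; ring.
Qed.

Lemma halfspace_approx_gauss_alg k : gauss_alg (hs k).
Proof.
apply/gauss_algB1/gauss_algX/gauss_algB1.
by apply: eq_gauss_alg (gauss_alg_gauss _ ltr01) => y; rewrite mul1r.
Qed.

Let w_itv k y : 0 <= 1 - expR (- sqdist (halfspace_centre s t j k) y) <= 1.
Proof.
by rewrite subr_ge0 expR_le1 oppr_le0 sqdist_ge0 gerBl expR_ge0.
Qed.

Lemma halfspace_approx_itv k y : 0 <= hs k y <= 1.
Proof.
have /andP[w0 w1] := w_itv k y.
by rewrite subr_ge0 exprn_ile1// gerBl exprn_ge0.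
Qed.

Lemma bernoulli (w : R) n : 0 <= w <= 1 -> 1 - n%:R * w <= (1 - w) ^+ n.
Proof.
move=> /andP[w0 w1]; elim: n => [|n IH]; first by rewrite mul0r subr0 expr0.
rewrite exprS -natr1; have : 0 <= n%:R :> R by [].
set N : R := n%:R in IH *; move=> N0.
apply: le_trans (_ : (1 - w) * (1 - N * w) <= _); last by rewrite ler_wpM2l// subr_ge0.
by nra.
Qed.

(** By Bernoulli. Outside the half-space the squared distance to the centre is at
    least (u^2 + 1 / u)^2 >= u^4 + 2 u. *)
Lemma halfspace_approx_out k (y : 'rV[R]_p) : 0 <= s * (y 0 j - t 0 j) ->
  hs k y <= expR (- (2 * k.+1%:R)).
Proof.
move=> ly; rewrite /halfspace_approx.
set w := expR (- _); set N := Num.truncn _.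
have w01 : 0 <= w <= 1.
  by rewrite expR_ge0/= /w expR_le1 oppr_le0 sqdist_ge0.
apply: (@le_trans _ _ (N%:R * w)); first by have := bernoulli N w01; lra.
have NE : N%:R <= expR (k.+1%:R ^+ 4) :> R by rewrite truncn_le// expR_ge0.
apply: (@le_trans _ _ (expR (k.+1%:R ^+ 4) * w)).
  by rewrite ler_wpM2r//; case/andP: w01.
rewrite -expRD ler_expR sqdist_halfspace_centre.
have k0 : k.+1%:R != 0 :> R by rewrite pnatr_eq0.
set u : R := k.+1%:R; have u0 : 0 < u by [].
have v0 : 0 < u^-1 by rewrite invr_gt0.
have -> : (u ^+ 2 + u^-1) ^+ 2 = u ^+ 4 + 2 * u + u^-1 ^+ 2 by field.
have := sqdist_ge0 t y; set S := sqdist t y => S0.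
have : 0 <= 2 * (u ^+ 2 + u^-1) * (s * (y 0 j - t 0 j)).
  have d0 : 0 < u ^+ 2 + u^-1 by rewrite addr_gt0 ?exprn_gt0.
  by apply: mulr_ge0 => //; rewrite mulr_ge0// ltW.
have : 0 <= u^-1 ^+ 2 by rewrite sqr_ge0.
move: (u^-1 ^+ 2) (2 * (u ^+ 2 + u^-1) * _) => Q P; lra.
Qed.

(** By (1 - w)^N <= exp (- N w): at a fixed point inside, N w grows because the
    squared distance to the centre is u^4 - 2 u^2 e + O(u), where e > 0 is the
    distance to the boundary. *)
Lemma halfspace_approx_in (y : 'rV[R]_p) : s * (y 0 j - t 0 j) < 0 ->
  hs k y @[k --> \oo] --> (1 : R).
Proof.
move=> ly.
pose A k : R := k.+1%:R ^+ 4 - sqdist (halfspace_centre s t j k) y.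
have lower k : 1 - expR (- A k) <= hs k y.
  rewrite /halfspace_approx lerD2l lerN2.
  set w := expR (- _); set N := Num.truncn _.
  have w0 : 0 <= w by exact: expR_ge0.
  have w1 : w <= 1 by rewrite /w expR_le1 oppr_le0 sqdist_ge0.
  have NE : expR (k.+1%:R ^+ 4) < N%:R + 1 :> R by rewrite natr1 truncnS_gt.
  have A1 : A k <= N%:R * w.
    have : expR (k.+1%:R ^+ 4) * w <= N%:R * w + w.
      by rewrite -[X in _ <= _ + X]mul1r -mulrDl ler_wpM2r// ltW.
    have -> : expR (k.+1%:R ^+ 4) * w = expR (A k) by rewrite /w -expRD.
    by have := expR_ge1Dx (A k); lra.
  apply: (@le_trans _ _ (expR (- w) ^+ N)).
    by rewrite lerXn2r ?nnegrE ?subr_ge0 ?expR_ge0// expR_ge1Dx.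
  by rewrite -expRM_natl ler_expR mulrN lerN2.
have Ay : A k @[k --> \oo] --> +oo.
  apply/cvgryPge => B; pose e := - (s * (y 0 j - t 0 j)).
  have e0 : 0 < e by rewrite oppr_gt0.
  have big_k (c : R) : \forall k \near \oo, c <= k.+1%:R :> R.
    near=> k; apply: (@le_trans _ _ k%:R); last by rewrite ler_nat.
    by near: k; exact: nbhs_infty_ger.
  near=> k.
  (* 2 u^2 e exceeds 2 u by 2 u as soon as 2 / e <= u *)
  have k1 : 2 / e <= k.+1%:R by near: k; exact: big_k.
  have k2 : (B + sqdist t y + 1) / 2 <= k.+1%:R by near: k; exact: big_k.
  rewrite ler_pdivrMr// in k1; rewrite ler_pdivrMr// in k2.
  rewrite /A sqdist_halfspace_centre -[s * _]opprK -/e; clearbody e.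
  have k0 : k.+1%:R != 0 :> R by rewrite pnatr_eq0.
  have u1 : 1 <= k.+1%:R :> R by rewrite ler1n.
  move: k0 u1 k1 k2; set u : R := k.+1%:R => k0 u1 k1 k2.
  have v0 : 0 < u^-1 by rewrite invr_gt0 (lt_le_trans ltr01).
  have v1 : u^-1 ^+ 2 <= 1 by rewrite expr_le1 ?(ltW v0)// invf_le1// (lt_le_trans ltr01).
  have -> : (u ^+ 2 + u^-1) ^+ 2 = u ^+ 4 + 2 * u + u^-1 ^+ 2 by field.
  have : 0 <= u^-1 * e by rewrite mulr_ge0// ltW.
  have : 2 * u <= u ^+ 2 * e.
    by rewrite expr2 mulrC -mulrA ler_pM2l// (lt_le_trans ltr01).
  rewrite (_ : 2 * _ * - e = - (2 * (u ^+ 2 * e) + 2 * (u^-1 * e))); last by ring.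
  move: (u^-1 ^+ 2) (u ^+ 2 * e) (u^-1 * e) v1 => Q P P'; lra.
have cA : 1 - expR (- A k) @[k --> \oo] --> (1 : R).
  rewrite -[X in _ --> X]subr0; apply: cvgB; first exact: cvg_cst.
  exact: (cvg_comp _ _ Ay (@cvgr_expR R)).
apply: (@squeeze_cvgr _ _ _ _ (fun k => 1 - expR (- A k)) (fun=> 1) (hs ^~ y) _ 1 cA);
  last exact: cvg_cst.
near=> k; rewrite lower/=; case/andP: (halfspace_approx_itv k y).
Unshelve. all: by end_near. Qed.

End halfspace.

(** * Convergence of distribution functions *)

Lemma has_mean_dominated_cvg d (T : measurableType d) (R : realType)
    (mu : probability T R) (f : nat -> T -> R) (g : T -> R) (c : R) :
  (forall k, measurable_fun setT (f k)) -> measurable_fun setT g ->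
  (forall k y, `|f k y| <= c) -> (forall y, f k y @[k --> \oo] --> g y) ->
  \int[mu]_y f k y @[k --> \oo] --> \int[mu]_y g y.
Proof.
move=> mf mg fc fg.
have [] := @dominated_convergence _ _ _ mu setT measurableT
  (fun k y => (f k y)%:E) (fun y => (g y)%:E) (fun=> c%:E).
- by move=> k; exact/measurable_EFinP.
- exact/measurable_EFinP.
- by apply: aeW => y _; apply: cvg_EFin; [exact: nearW|exact: fg].
- exact: finite_measure_integrable_cst.
- by apply: aeW => y k _; rewrite /= lee_fin.
move=> ig _ cv; apply: fine_cvg.
by rewrite fineK//; exact: integrable_fin_num.
Qed.

Section portmanteau.
Context {R : realType} {p : nat} (mu : probability (borel_rV R p) R).
Context (I : nat -> finType) (x : forall n, I n -> 'rV[R]_p).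
Hypothesis I0 : \forall n \near \oo, (0 < #|I n|)%N.
Hypothesis gauss_cvg : forall f, gauss_alg f ->
  avg_cvg mu x f.

(** Half of the portmanteau theorem: by dominated convergence some f k has a mean
    close to the mass of U, while f k exceeds the indicator of U by at most e k. *)
Lemma open_liminf (U : set 'rV[R]_p) (mU : measurable (U : set (borel_rV R p)))
    (f : nat -> 'rV[R]_p -> R) (e : nat -> R) :
  (forall k, gauss_alg (f k)) -> (forall k y, 0 <= f k y <= 1) ->
  (forall k y, ~ U y -> f k y <= e k) -> e k @[k --> \oo] --> 0 ->
  (forall y, U y -> f k y @[k --> \oo] --> (1 : R)) ->
  forall eta, 0 < eta -> \forall n \near \oo, fine (mu U) - eta <= avg x n \1_U.
Proof.
move=> gf f01 fout e0 fin eta eta0.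
pose g k y := f k y * \1_U y.
have m1 : measurable_fun setT (\1_U : borel_rV R p -> R) by exact: measurable_indic.
have mf k : measurable_fun setT (f k : borel_rV R p -> R).
  have [v [fi _] _] := gauss_cvg (gf k).
  by apply/measurable_EFinP; exact: measurable_int fi.
have mg k : measurable_fun setT (g k : borel_rV R p -> R) by exact: measurable_funM.
have gU y : g k y @[k --> \oo] --> (\1_U y : R).
  rewrite -[X in _ --> X]mul1r /g indicE; have [/set_mem Uy|NUy] := boolP (y \in U).
    by apply: cvgMr_tmp; exact: fin.
  by rewrite mulr0; under eq_fun do rewrite mulr0; exact: cvg_cst.
have g1 k y : `|g k y| <= 1.
  have /andP[a0 a1] := f01 k y; rewrite normrM ger0_norm// indicE.
  by case: (_ \in _); rewrite ?normr1 ?normr0 ?mulr1 ?mulr0.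
have := has_mean_dominated_cvg (mu := mu) mg m1 g1 gU.
have -> : \int[mu]_y \1_U y = fine (mu U) :> R.
  by rewrite /Rintegral integral_indic// setIT.
move=> cg.
have eta3 : 0 < eta / 3 by rewrite divr_gt0.
have near1 : \forall k \near \oo, fine (mu U) - eta / 3 <= \int[mu]_y g k y.
  by apply: (cvgr_ge _ cg); rewrite gtrBl.
have near2 : \forall k \near \oo, e k <= eta / 3 by apply: (cvgr_le _ e0).
have [k [gk ek]] : exists k, fine (mu U) - eta / 3 <= \int[mu]_y g k y /\ e k <= eta / 3.
  near \oo => k; exists k; split; by near: k.
have [v fv fcv] := gauss_cvg (gf k).
have gv : \int[mu]_y g k y <= v.
  apply: (has_mean_le (has_mean_bounded mu (mg k) (g1 k)) fv) => y.
  rewrite /g indicE; have /andP[a0 a1] := f01 k y.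
  by case: (_ \in _); rewrite ?mulr1 ?mulr0.
have near3 : \forall n \near \oo, v - eta / 3 <= avg x n (f k).
  by apply: (cvgr_ge _ fcv); rewrite gtrBl.
near=> n.
have h1 : v - eta / 3 <= avg x n (f k) by near: n.
have h2 : avg x n (f k) <= avg x n (fun y => \1_U y + eta / 3).
  apply: avg_le => y; rewrite indicE; have [Uy|/negP NUy] := boolP (y \in U).
    by have /andP[a0 a1] := f01 k y; rewrite (le_trans a1)// lerDl ltW.
  rewrite add0r (le_trans _ ek)//; apply: fout => Uy; apply: NUy; exact/mem_set.
rewrite avgD avg_cst in h2; last by near: n.
by lra.
Unshelve. all: by end_near. Qed.

Lemma measurable_open_orthant (t : 'rV[R]_p) :
  measurable ([set y : 'rV[R]_p | forall j, y 0 j < t 0 j] : set (borel_rV R p)).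
Proof.
have -> : [set y : 'rV[R]_p | forall j, y 0 j < t 0 j] =
    \bigcap_(j in [set: 'I_p]) [set y | y 0 j < t 0 j].
  by apply/seteqP; split => y /= h j; [move=> _; exact: h|exact: (h j Logic.I)].
apply: fin_bigcap_measurable => // j _; apply: sub_sigma_algebra.
apply: (@open_comp _ _ (fun y : 'rV[R]_p => y 0 j) [set r | r < t 0 j]); last exact: open_lt.
by move=> y _; exact: coord_continuous.
Qed.

Lemma measurable_closed_orthant (t : 'rV[R]_p) :
  measurable ([set y : 'rV[R]_p | forall j, y 0 j <= t 0 j] : set (borel_rV R p)).
Proof.
have -> : [set y : 'rV[R]_p | forall j, y 0 j <= t 0 j] =
    \bigcap_(j in [set: 'I_p]) ~` [set y | t 0 j < y 0 j].
  apply/seteqP; split => y /= h j; first by move=> _ /=; rewrite ltNge h.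
  by have := h j Logic.I => /negP; rewrite -leNgt.
apply: fin_bigcap_measurable => // j _; apply: measurableC; apply: sub_sigma_algebra.
apply: (@open_comp _ _ (fun y : 'rV[R]_p => y 0 j) [set r | t 0 j < r]); last exact: open_gt.
by move=> y _; exact: coord_continuous.
Qed.

End portmanteau.

Section cdf.
Context {R : realType} {p : nat} (mu : probability (borel_rV R p) R).

(** The closed orthants below t - 1 / (k + 1) lie in the open one, and their masses
    tend to that of the closed orthant below t. *)
Lemma mass_open_orthant (t : 'rV[R]_p) : {for t, continuous (joint_cdf mu)} ->
  fine (mu [set y : 'rV[R]_p | forall j, y 0 j < t 0 j]) = joint_cdf mu t.
Proof.
move=> ct; set U := [set y | _].
have le_mu (A B : set 'rV[R]_p) : measurable (A : set (borel_rV R p)) ->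
    measurable (B : set (borel_rV R p)) -> A `<=` B -> fine (mu A) <= fine (mu B).
  move=> mA mB AB; apply: fine_le; [exact: fin_num_measure|exact: fin_num_measure|].
  by apply: le_measure; rewrite ?inE.
apply/eqP; rewrite eq_le; apply/andP; split.
  apply: le_mu; [exact: measurable_open_orthant|exact: measurable_closed_orthant|].
  by move=> y h j; exact: ltW.
have st : (t - k.+1%:R^-1 *: const_mx 1) @[k --> \oo] --> t.
  apply/cvg_ballP => e e0; near=> k; split=> // i j.
  rewrite /ball/= !mxE mulr1 opprB addrC subrK ger0_norm ?invr_ge0//.
  by near: k; exact: near_infty_natSinv_lt (PosNum e0).
have cF : joint_cdf mu (t - k.+1%:R^-1 *: const_mx 1) @[k --> \oo] --> joint_cdf mu t.
  exact: (cvg_comp _ _ st ct).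
apply: (ler_cvg_to cF (cvg_cst _)); near=> k.
apply: le_mu; [exact: measurable_closed_orthant|exact: measurable_open_orthant|].
move=> y h j; rewrite (le_lt_trans (h j))// !mxE mulr1 ltrBlDr ltrDl invr_gt0.
by rewrite ltr0n.
Unshelve. all: by end_near. Qed.

Context (I : nat -> finType) (x : forall n, I n -> 'rV[R]_p).
Hypothesis I0 : \forall n \near \oo, (0 < #|I n|)%N.
Hypothesis gauss_cvg : forall f, gauss_alg f ->
  avg_cvg mu x f.

(** The lower bound on the mass of the open orthant below t bounds the empirical
    distribution function from below; the one on the complement of the closed
    orthant bounds it from above. *)
Lemma cdf_cvg :
  cvg_in_distribution (fun n => empirical_cdf (@x n)) (joint_cdf mu).
Proof.
move=> t ct.
pose U := [set y : 'rV[R]_p | forall j, y 0 j < t 0 j].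
pose A := [set y : 'rV[R]_p | forall j, y 0 j <= t 0 j].
have empE n : empirical_cdf (@x n) t = avg x n \1_A.
  rewrite /empirical_cdf /avg; congr (_ / _); apply: eq_bigr => i _.
  rewrite indicE; congr ((nat_of_bool _)%:R).
  by apply/forallP/idP => [h|/set_mem//]; exact/mem_set.
have e0 : expR (- (2 * k.+1%:R)) @[k --> \oo] --> (0 : R).
  apply: (cvg_comp (fun k => 2 * k.+1%:R) (fun r => expR (- r)) _ (@cvgr_expR R)).
  apply/cvgryPge => B; near=> k; apply: (@le_trans _ _ k%:R); last first.
    by rewrite -natrM ler_nat (leq_trans (leqnSn k))// leq_pmull.
  by near: k; exact: nbhs_infty_ger.
have e_itv k : 0 <= expR (- (2 * k.+1%:R) : R) <= 1.
  by rewrite expR_ge0 expR_le1 oppr_le0 mulr_ge0.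
have lowerU := open_liminf I0 gauss_cvg
  (measurable_open_orthant t : measurable (U : set (borel_rV R p)))
  (f := fun k y => \prod_(j < p) halfspace_approx 1 t j k y)
  (e := fun k => expR (- (2 * k.+1%:R))).
have lowerA := open_liminf I0 gauss_cvg
  (measurableC (measurable_closed_orthant t) : measurable (~` A : set (borel_rV R p)))
  (f := fun k y => 1 - \prod_(j < p) (1 - halfspace_approx (-1) t j k y))
  (e := fun k => 1 - (1 - expR (- (2 * k.+1%:R))) ^+ p).
have N1 : (- 1) ^+ 2 = 1 :> R by rewrite sqrrN expr1n.
have oneB_itv k j y : 0 <= 1 - halfspace_approx (-1) t j k y <= 1.
  have /andP[h0 h1] := halfspace_approx_itv (-1) t j k y.
  by rewrite subr_ge0 h1 gerBl.
have hU : forall eta, 0 < eta -> \forall n \near \oo, joint_cdf mu t - eta <= avg x n \1_A.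
  move=> eta eta0; rewrite -(mass_open_orthant ct); move: eta eta0.
  have UA n : avg x n \1_U <= avg x n \1_A.
    apply: avg_le => y; rewrite !indicE ler_nat; case: (boolP (y \in U)) => // /set_mem Uy.
    by rewrite mem_set// => j; exact: ltW.
  move=> eta eta0; suff : \forall n \near \oo, fine (mu U) - eta <= avg x n \1_U.
    by apply: filterS => n /le_trans; apply.
  apply: lowerU => //.
  - by move=> k; apply: gauss_alg_prod => j; exact: halfspace_approx_gauss_alg.
  - move=> k y; rewrite prodr_ge0/= => [|j _].
      by rewrite prodr_ile1// => j _; exact: halfspace_approx_itv.
    by case/andP: (halfspace_approx_itv 1 t j k y).
  - move=> k y /existsNP[j /negP]; rewrite -leNgt => tj.
    rewrite (bigD1 j)//=.
    rewrite (le_trans _ (halfspace_approx_out _ k (y := y) (s := 1) (t := t) (j := j) _))//.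
    + rewrite ler_piMr//; first by case/andP: (halfspace_approx_itv 1 t j k y).
      by rewrite prodr_ile1// => i _; exact: halfspace_approx_itv.
    + by rewrite expr1n.
    + by rewrite mul1r subr_ge0.
  - move=> y Uy; rewrite [X in _ --> X](_ : _ = \prod_(j < p) (1 : R)); last by rewrite big1.
    apply: cvg_big; first exact: mul_continuous.
    move=> j _; apply: halfspace_approx_in; first by rewrite expr1n.
    by rewrite mul1r subr_lt0; exact: Uy.
have hA : forall eta, 0 < eta ->
    \forall n \near \oo, avg x n \1_A <= joint_cdf mu t + eta.
  move=> eta eta0.
  have muC : fine (mu (~` A)) = 1 - joint_cdf mu t.
    rewrite probability_setC; last exact: measurable_closed_orthant.
    by rewrite fineB// fin_num_measure//; exact: measurable_closed_orthant.
  have avgC : \forall n \near \oo, avg x n \1_(~` A) = 1 - avg x n \1_A.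
    near=> n; rewrite -[1](@avg_cst _ _ _ x n 1); last by near: n.
    rewrite -mulN1r -avgZ -avgD; congr avg; apply/funext => y.
    rewrite !indicE in_setC mulN1r; case: (_ \in _) => /=; first by rewrite subrr.
    by rewrite subr0.
  have : \forall n \near \oo, fine (mu (~` A)) - eta <= avg x n \1_(~` A).
    apply: lowerA => //.
    + by move=> k; apply/gauss_algB1/gauss_alg_prod => j; apply: gauss_algB1;
        exact: halfspace_approx_gauss_alg.
    + move=> k y; rewrite gerBl subr_ge0 prodr_ile1/= => [|j _].
        by rewrite prodr_ge0// => j _; case/andP: (oneB_itv k j y).
      exact: oneB_itv.
    + move=> k y /contrapT Ay; rewrite lerD2l lerN2 -[p in X in X <= _]card_ord -prodr_const.
      apply: ler_prod => j _; have /andP[e1 e2] := e_itv k.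
      rewrite subr_ge0 e2 lerD2l lerN2; apply: halfspace_approx_out => //.
      by rewrite mulN1r opprB subr_ge0; exact: Ay.
    + rewrite [X in _ --> X](_ : _ = 1 - (1 - 0) ^+ p); last by rewrite subr0 expr1n subrr.
      have c1 : 1 - expR (- (2 * k.+1%:R)) @[k --> \oo] --> (1 - 0 : R).
        by apply: cvgB => //; exact: cvg_cst.
      apply: cvgB; first exact: cvg_cst.
      exact: (cvg_comp _ _ c1 (@exprn_continuous R p _)).
    + move=> y /existsNP[j /negP]; rewrite -ltNge => tj.
      have cj : halfspace_approx (-1) t j k y @[k --> \oo] --> (1 : R).
        by apply: halfspace_approx_in => //; rewrite mulN1r oppr_lt0 subr_gt0.
      apply: (@squeeze_cvgr _ _ _ _ (fun k => halfspace_approx (-1) t j k y) (fun=> 1)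
        _ _ 1 cj); last exact: cvg_cst.
      near=> k; rewrite gerBl; apply/andP; split; last first.
        by apply: prodr_ge0 => i _; case/andP: (oneB_itv k i y).
      rewrite lerBrDl -lerBrDr (bigD1 j)//= ler_piMr//; first by case/andP: (oneB_itv k j y).
      by apply: prodr_ile1 => i _; exact: oneB_itv.
  by apply: filterS2 avgC => n ->; rewrite muC; lra.
rewrite (_ : (fun n => _) = fun n => avg x n \1_A); last by apply/funext => n; exact: empE.
apply/cvgrPdist_le => e e_gt0.
near=> n.
have h1 : joint_cdf mu t - e <= avg x n \1_A by near: n; exact: hU.
have h2 : avg x n \1_A <= joint_cdf mu t + e by near: n; exact: hA.
by rewrite ler_norml; apply/andP; split; lra.
Unshelve. all: by end_near. Qed.
End cdf.

(** * Minimizers of the sliced energy *)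

Section conclusion.
Context {R : realType} {p : nat} (mu : probability (borel_rV R p) R).
Variables (X : set 'rV[R]_p).
Hypotheses (muX : {ae mu, forall y, X y}) (fe : finite_energy mu X).

(** A positive multiple of the energy bounds a square. *)
Lemma energy_ge0 (I : finType) (x : I -> 'rV[R]_p) : (0 < #|I|)%N ->
  (forall i, X (x i)) -> 0 <= energy mu x.
Proof.
move=> I0 Xx; pose f y := laplace_band 1 1 (sqdist (0 : 'rV[R]_p) y).
have mf : measurable_fun setT (f : borel_rV R p -> R).
  by apply: continuous_borel_measurable; exact: laplace_band_continuous.
have f1 y : `|f y| <= 1 by rewrite laplace_band_bound ?sqdist_ge0.
have hf2 : has_mean mu (fun y => f y ^+ 2) (\int[mu]_y (f y ^+ 2)).
  apply: (@has_mean_bounded _ _ _ _ _ 1); first exact: (measurable_funX 2 mf).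
  by move=> y; rewrite normrX exprn_ile1.
have := energy_dominated_le muX fe (laplace_band_dominated 0 ltr01 ltr01)
  (has_mean_bounded mu mf f1) hf2 I0 Xx.
move=> /(le_trans (sqr_ge0 _)); rewrite pmulr_rge0// !mulr_gt0 ?pi_gt0//.
by rewrite subr_gt0 /laplace_tail add0r !mulr1 !divr1 ltr_expR ltrN2 ltrDl.
Qed.

Lemma energy_cvg0_cdf (I : nat -> finType) (x : forall n, I n -> 'rV[R]_p) :
  (\forall n \near \oo, (0 < #|I n|)%N /\ forall i, X (@x n i)) ->
  energy mu (@x n) @[n --> \oo] --> 0 ->
  cvg_in_distribution (fun n => empirical_cdf (@x n)) (joint_cdf mu).
Proof.
move=> xX e0; apply: cdf_cvg; first by apply: filterS xX => n [].
exact: (avg_cvg_gauss_alg muX fe xX e0).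
Qed.

Section slices.
Context (K : nat) (m : 'I_K -> nat).
Hypothesis m_gt0 : forall k, (0 < m k)%N.
Local Notation n := (\sum_k m k)%N.

Lemma sum_slices (V : nmodType) (F : forall k : 'I_K, 'I_(m k) -> V) :
  \sum_(u : {k : 'I_K & 'I_(m k)}) F (tag u) (tagged u) = \sum_k \sum_i F k i.
Proof. by rewrite sig_big_dep. Qed.

Lemma card_slices : #|{: {k : 'I_K & 'I_(m k)}}| = n.
Proof.
by rewrite -sum1_card (sum_slices (fun _ _ => 1%N)); apply: eq_bigr => k _;
  rewrite sum1_card card_ord.
Qed.

(** The sliced energy is a quadratic form in the values of [centered_dist] on the
    points of all slices; the bound is the trace of its matrix of weights times the
    mean of the kernel on the diagonal. *)
Lemma exists_small_sliced_energy (lambda : R) : (0 < n)%N ->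
  exists2 y : slices R p m, (forall k i, X (y k i)) &
    sliced_energy mu lambda y <= (lambda + (1 - lambda) * K%:R) * mean_dist mu / n%:R.
Proof.
move=> n0; have n0' : n%:R != 0 :> R by rewrite pnatr_eq0 -lt0n.
(* the weight (m k / n) / m k ^ 2 of a pair of points of the slice k *)
pose c k : R := (1 - lambda) * (n%:R^-1 * (m k)%:R^-1).
pose W (u v : {k : 'I_K & 'I_(m k)}) : R :=
  lambda * (n%:R ^+ 2)^-1 + (tag u == tag v)%:R * c (tag u).
have Wsym u v : W u v = W v u.
  by rewrite /W eq_sym; case: eqP => [->//|]; rewrite !mul0r.
have [y Xy le_y] := greedy_sample (g := fun _ _ => 0) (c := fun=> 0) muX
  (centered_distC mu) (has_mean_centered_dist fe) (has_mean_centered_diag fe)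
  (fun _ => has_mean_cst mu 0) Wsym.
pose z : slices R p m := fun k i => y (Tagged (fun k => 'I_(m k)) i).
exists z; first by move=> k i; exact: Xy.
have yz u : y u = z (tag u) (tagged u) by rewrite /z; case: u.
pose S k := \sum_i \sum_j centered_dist mu (z k i) (z k j).
have offdiag : \sum_u \sum_v (tag u == tag v)%:R * c (tag u) * centered_dist mu (y u) (y v) =
    \sum_k c k * S k.
  under eq_bigr do under eq_bigr do rewrite yz yz.
  rewrite (sum_slices (fun k i => \sum_v (k == tag v)%:R * c k *
    centered_dist mu (z k i) (z (tag v) (tagged v)))).
  apply: eq_bigr => k _; rewrite mulr_sumr; apply: eq_bigr => i _.
  rewrite (sum_slices (fun l j => (k == l)%:R * c k * centered_dist mu (z k i) (z l j))).
  rewrite (bigD1 k)//= [X in _ + X]big1 ?addr0.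
    by rewrite mulr_sumr; apply: eq_bigr => j _; rewrite eqxx mul1r.
  by move=> l lk; rewrite big1// => j _; rewrite eq_sym (negPf lk) !mul0r.
have sliceE : (1 - lambda) * \sum_k (m k)%:R / n%:R * energy mu (z k) = \sum_k c k * S k.
  rewrite mulr_sumr; apply: eq_bigr => k _.
  have mk0 : (m k)%:R != 0 :> R by rewrite pnatr_eq0 -lt0n.
  by rewrite energyE card_ord// /c -/(S k); field; rewrite n0' mk0.
have unionE : lambda * energy mu (union_slices z) =
    \sum_u \sum_v lambda * (n%:R ^+ 2)^-1 * centered_dist mu (y u) (y v).
  rewrite energyE card_slices// mulrA mulr_sumr; apply: eq_bigr => u _.
  by rewrite mulr_sumr; apply: eq_bigr => v _; rewrite !yz.
have trace : \sum_u (W u u * mean_dist mu + 0) =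
    (lambda + (1 - lambda) * K%:R) * mean_dist mu / n%:R.
  have WE u : W u u * mean_dist mu + 0 =
      (lambda * (n%:R ^+ 2)^-1 + c (tag u)) * mean_dist mu.
    by rewrite addr0 /W eqxx mul1r.
  rewrite (eq_bigr _ (fun u _ => WE u)) -mulr_suml big_split/= sum_cst card_slices.
  rewrite (sum_slices (fun k _ => c k)).
  have -> : \sum_k \sum_(i < m k) c k = (1 - lambda) * K%:R / n%:R.
    have mc k : \sum_(i < m k) c k = (1 - lambda) / n%:R.
      have mk0 : (m k)%:R != 0 :> R by rewrite pnatr_eq0 -lt0n.
      by rewrite sum_cst card_ord /c; field; rewrite n0' mk0.
    by rewrite (eq_bigr _ (fun k _ => mc k)) sum_cst card_ord; field.
  by field.
rewrite -trace; apply: le_trans le_y; rewrite [X in _ <= _ + X]big1// addr0.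
rewrite /sliced_energy sliceE unionE -offdiag -big_split/=.
rewrite ler_sum// => u _; rewrite -big_split/= ler_sum// => v _.
by rewrite -mulrDl.
Qed.

Lemma empirical_cdf_union (x : slices R p m) (t : 'rV[R]_p) :
  empirical_cdf (union_slices x) t = \sum_k (m k)%:R / n%:R * empirical_cdf (x k) t.
Proof.
rewrite /empirical_cdf card_slices /union_slices.
rewrite (sum_slices (fun k i => ([forall j, x k i 0 j <= t 0 j] : nat)%:R)) mulr_suml.
apply: eq_bigr => k _; rewrite card_ord mulrAC; congr (_ / _).
by rewrite mulrC divfK// pnatr_eq0 -lt0n.
Qed.

End slices.
End conclusion.

Theorem theorem4 (R : realType) (p : nat) (X : set 'rV[R]_p)
    (mu : probability (borel_rV R p) R)
    (mu_X : {ae mu, forall y, X y})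
    (F_continuous : continuous (joint_cdf mu))
    (mu_energy : finite_energy mu X)
    (lambda : R) (lambda_ge0 : 0 <= lambda) (lambda_le1 : lambda <= 1)
    (K : nat) (K_gt0 : (0 < K)%N)
    (m : nat -> 'I_K -> nat)
    (m_gt0 : forall n, (K <= n)%N -> forall k, (0 < m n k)%N)
    (m_sum : forall n, (K <= n)%N -> (\sum_k m n k)%N = n)
    (c : 'I_K -> R) (c_gt0 : forall k, 0 < c k)
    (m_cvg : forall k, ((m n k)%:R / n%:R : R) @[n --> \oo] --> c k)
    (P : forall n, slices R p (m n))
    (P_min : forall n, (K <= n)%N ->
       minimizes_sliced_energy mu X lambda (P n)) :
  cvg_in_distribution
    (fun n => empirical_cdf (union_slices (P n))) (joint_cdf mu) /\
  (lambda < 1 \/ K = 1%N -> forall k,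
    cvg_in_distribution (fun n => empirical_cdf (P n k)) (joint_cdf mu)).
Proof.
have nK : \forall n \near \oo, (K <= n)%N by exact: nbhs_infty_ge.
pose B := (lambda + (1 - lambda) * K%:R) * mean_dist mu.
have small n : (K <= n)%N -> sliced_energy mu lambda (P n) <= B / n%:R.
  move=> Kn; have n0 : (0 < \sum_k m n k)%N by rewrite m_sum// (leq_trans K_gt0).
  have [y Xy le_y] := exists_small_sliced_energy mu_X mu_energy (m_gt0 n Kn) lambda n0.
  apply: le_trans ((P_min n Kn).2 y Xy) _.
  by rewrite m_sum in le_y.
have slice_ge0 n k : (K <= n)%N -> 0 <= energy mu (P n k).
  move=> Kn; apply: (energy_ge0 mu_X mu_energy); first by rewrite card_ord m_gt0.
  by move=> i; exact: (P_min n Kn).1.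
have union_X n : (K <= n)%N -> (0 < #|{: {k : 'I_K & 'I_(m n k)}}|)%N /\
    forall u, X (union_slices (P n) u).
  move=> Kn; split; first by rewrite card_slices m_sum// (leq_trans K_gt0).
  by move=> u; exact: (P_min n Kn).1.
have union_ge0 n : (K <= n)%N -> 0 <= energy mu (union_slices (P n)).
  by move=> /union_X[u0 uX]; exact: (energy_ge0 mu_X mu_energy).
have unionE t : \forall n \near \oo, empirical_cdf (union_slices (P n)) t =
    \sum_k (m n k)%:R / n%:R * empirical_cdf (P n k) t.
  apply: filterS nK => n Kn.
  by rewrite (empirical_cdf_union (m_gt0 n Kn)) m_sum.
have B0 : B / n%:R @[n --> \oo] --> 0.
  rewrite -(mulr0 B); apply: cvgMl_tmp; rewrite -cvg_shiftS; exact: cvg_harmonic.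
have slices_cvg : lambda < 1 -> forall k,
    cvg_in_distribution (fun n => empirical_cdf (P n k)) (joint_cdf mu).
  move=> l1 k; apply: (energy_cvg0_cdf mu_X mu_energy).
    apply: filterS nK => n Kn; rewrite card_ord m_gt0//; split=> // i.
    exact: (P_min n Kn).1.
  have dk : 0 < (1 - lambda) * c k by rewrite mulr_gt0// subr_gt0.
  have wk : (1 - lambda) * ((m n k)%:R / n%:R) @[n --> \oo] --> (1 - lambda) * c k.
    exact: cvgMl_tmp.
  have bound : (B / n%:R) / ((1 - lambda) * ((m n k)%:R / n%:R)) @[n --> \oo] --> 0.
    rewrite -(mul0r ((1 - lambda) * c k)^-1); apply: cvgM => //.
    by apply: cvgV => //; rewrite gt_eqF.
  apply: (@squeeze_cvgr _ _ _ _ (fun=> 0) _ (fun n => energy mu (P n k)) _ 0 (cvg_cst 0) bound).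
  apply: filterS nK => n Kn; rewrite slice_ge0//=.
  have n0 : 0 < n%:R :> R by rewrite ltr0n (leq_trans K_gt0).
  have w0 l : 0 < (m n l)%:R / n%:R :> R by rewrite divr_gt0// ltr0n m_gt0.
  have dn : 0 < (1 - lambda) * ((m n k)%:R / n%:R) by rewrite mulr_gt0 ?w0 ?subr_gt0.
  rewrite ler_pdivlMr//; apply: le_trans (small n Kn).
  rewrite /sliced_energy m_sum// mulrC -mulrA; apply: ler_wpDl.
    by rewrite mulr_ge0// union_ge0.
  rewrite ler_pM2l ?subr_gt0// (bigD1 k)//= lerDl.
  by apply: sumr_ge0 => l _; rewrite mulr_ge0 ?(ltW (w0 l)) ?slice_ge0.
have [l1|l1] : lambda < 1 \/ lambda = 1.
    by move: lambda_le1; rewrite le_eqVlt => /predU1P[->|]; [right|left].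
  split; last by move=> _; exact: slices_cvg.
  move=> t ct.
  have c1 : \sum_k c k = 1.
    have cs : \sum_k (m n k)%:R / n%:R @[n --> \oo] --> \sum_k c k.
      by apply: cvg_sumT => k _.
    have c1 : \sum_k (m n k)%:R / n%:R @[n --> \oo] --> (1 : R).
      apply: cvg_near_cst; apply: filterS nK => n Kn.
      rewrite -mulr_suml -natr_sum m_sum// divff// pnatr_eq0 -lt0n.
      exact: leq_trans Kn.
    exact: cvg_unique cs c1.
  rewrite -[joint_cdf mu t]mul1r -c1 mulr_suml.
  apply/cvgrPdist_le => e e0.
  have cs : \sum_k (m n k)%:R / n%:R * empirical_cdf (P n k) t @[n --> \oo] -->
      \sum_k c k * joint_cdf mu t.
    by apply: cvg_sumT => k _; apply: cvgM => //; exact: slices_cvg.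
  move/cvgrPdist_le : cs => /(_ e e0).
  by apply: filterS2 (unionE t) => n ->.
have union_cvg : cvg_in_distribution (fun n => empirical_cdf (union_slices (P n))) (joint_cdf mu).
  apply: (energy_cvg0_cdf mu_X mu_energy); first by apply: filterS nK => n /union_X.
  apply: (@squeeze_cvgr _ _ _ _ (fun=> 0) _ (fun n => energy mu (union_slices (P n))) _ 0
    (cvg_cst 0) B0).
  apply: filterS nK => n Kn; rewrite union_ge0//=.
  by have := small n Kn; rewrite /sliced_energy l1 subrr mul0r addr0 mul1r.
split=> // -[|K1 k t ct]; first by rewrite l1 ltxx.
subst K; apply/cvgrPdist_le => e e0.
move/cvgrPdist_le : (union_cvg t ct) => /(_ e e0).
apply: filterS3 nK (unionE t) => n Kn ->; rewrite big_ord1 (ord1 k).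
have n0 : n%:R != 0 :> R by rewrite pnatr_eq0 -lt0n.
have mn : m n ord0 = n by have := m_sum n Kn; rewrite big_ord1.
by rewrite (_ : (m n ord0)%:R = n%:R :> R) ?mn// divff// mul1r.
Qed.
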